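(* As $n\to\infty$, the non-commutative distribution of the family $(M_r(n,t))_{r\geq 1,\, t\in[0,+\infty)}$ in $(\mathbb{C}[\mathcal{S}],\varphi)$ converges to the non-commutative distribution of a family $(M_r(t))_{r\geq 1,\, t\in[0,+\infty)}$ such that $(M_1(t))_{t\in[0,+\infty)}$ is a free Brownian motion and, for all $r\geq 1$ and $t\in[0,+\infty)$, $$M_r(t)=t^{r/2}\,U_r\bigl(t^{-1/2}M_1(t)\bigr),$$ where the $U_r$'s are the Chebyshev polynomials of the second kind.
   Context: A non-commutative probability space is a complex unital $*$-algebra $\mathcal{A}$ with a linear form $\varphi$ such that $\varphi(1)=1$, $\varphi(x^* )=\overline{\varphi(x)}$ and $\varphi(xx^* )\geq 0$ for all $x\in\mathcal{A}$. The non-commutative distribution of a family $(x_i)_{i\in I}$ of self-adjoint elements of $\mathcal{A}$ is the map sending each polynomial $P$ in non-commuting variables $(X_i)_{i\in I}$ to $\varphi(P((x_i)_{i\in I}))$; convergence of non-commutative distributions means pointwise convergence on every such $P$. $\mathcal{S}$ is the group of finitely supported permutations of the set of nonnegative integers. $\mathbb{C}[\mathcal{S}]$ is its group algebra, with involution $(\sum_\sigma x_\sigma\sigma)^*=\sum_\sigma\overline{x_\sigma}\sigma^{-1}$ and canonical trace $\varphi(\sum_\sigma x_\sigma\sigma)=x_{\mathrm{id}}$, where $\mathrm{id}$ is the identity permutation. For integers $r\geq1$, $n\geq1$ and $t\in[0,+\infty)$, $$M_r(n,t)=\frac{1}{n^{r/2}}\sum(0\,a_1\,a_2\cdots a_r)\in\mathbb{C}[\mathcal{S}],$$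 where the sum runs over all $r$-tuples $(a_1,\ldots,a_r)$ of pairwise distinct integers of $[1,nt]$, and $(0\,a_1\cdots a_r)$ denotes the cycle $0\to a_1\to\cdots\to a_r\to0$. A free Brownian motion is a process $(S_t)_{t\in[0,+\infty)}$ of (self-adjoint) non-commutative random variables with free increments such that for all $t$, $S_t$ is semi-circular (centered) with variance $t$. The Chebyshev polynomials of the second kind $U_n$ are normalized by $U_0(x)=1$, $U_1(x)=x$, $U_1(x)U_n(x)=U_{n-1}(x)+U_{n+1}(x)$ for $n\geq1$ (orthogonal on $[-2,2]$ for the weight $\frac{1}{2\pi}\sqrt{4-x^2}$). The expression $t^{r/2}U_r(t^{-1/2}x)$ is a polynomial in $x$ and $t$, and this is how it is understood at $t=0$. *)

(* Defs.v *)
From HB Require Import structures.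
From mathcomp Require Import all_boot all_order all_algebra.
From mathcomp Require Import finmap monalg complex.
From mathcomp Require Import all_classical all_reals all_analysis.

Set Implicit Arguments.
Unset Strict Implicit.
Unset Printing Implicit Defensive.

Import Order.TTheory GRing.Theory Num.Theory numFieldNormedType.Exports.

Local Open Scope classical_set_scope.
Local Open Scope complex_scope.
Local Open Scope ring_scope.

Record finPerm : predArgType := FinPerm {
  finperm_val :> {fsfun nat -> nat};
  _ : `[< bijective finperm_val >] }.

HB.instance Definition _ := [isSub for finperm_val].
HB.instance Definition _ := [Choice of finPerm by <:].

Section FinPermGroup.

Lemma finperm_bij (s : finPerm) : bijective s.
Proof. by case: s => s /= /asboolP. Qed.

Lemma finpermP (s t : finPerm) : s =1 t -> s = t.
Proof. by move=> st; apply/val_inj/fsfunP. Qed.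

Fact finperm1_subproof : `[< bijective ([fsfun] : {fsfun nat -> nat}) >].
Proof. by apply/asboolP; exists id => x; rewrite !fsfun0E. Qed.
Definition finperm1 : finPerm := FinPerm finperm1_subproof.

Fact finpermM_subproof (s t : finPerm) : `[< bijective (fsfun_comp s t) >].
Proof.
apply/asboolP; apply: (eq_bij (bij_comp (finperm_bij s) (finperm_bij t))) => x.
by rewrite -[LHS]fscompE.
Qed.
Definition finpermM (s t : finPerm) : finPerm := FinPerm (finpermM_subproof s t).

Fact finperm_inv_ex (s : finPerm) :
  exists t : {fsfun nat -> nat}, cancel s t /\ cancel t s.
Proof.
have [g sK gK] := finperm_bij s.
pose t : {fsfun nat -> nat} := [fsfun x in finsupp s => g x].
have gE : t =1 g.
  move=> x; rewrite [LHS]fsfun_fun; case: ifPn => // xs.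
  by apply: (can_inj sK); rewrite gK fsfun_dflt.
by exists t; split=> x; rewrite gE.
Qed.
Definition finpermV_val (s : finPerm) := projT1 (cid (finperm_inv_ex s)).
Lemma finpermV_valK (s : finPerm) : cancel s (finpermV_val s).
Proof. by rewrite /finpermV_val; case: cid => t []. Qed.
Lemma finpermV_valKV (s : finPerm) : cancel (finpermV_val s) s.
Proof. by rewrite /finpermV_val; case: cid => t []. Qed.
Fact finpermV_subproof (s : finPerm) : `[< bijective (finpermV_val s) >].
Proof.
by apply/asboolP; exists s; [exact: finpermV_valKV | exact: finpermV_valK].
Qed.
Definition finpermV (s : finPerm) : finPerm := FinPerm (finpermV_subproof s).

Lemma finperm1E x : finperm1 x = x.
Proof. exact: fsfun0E. Qed.
Lemma finpermME (s t : finPerm) x : finpermM s t x = s (t x).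
Proof. exact: fscompE. Qed.

Fact finpermA : associative finpermM.
Proof. by move=> s t u; apply: finpermP => x; rewrite !finpermME. Qed.
Fact finperm_mul1 : left_id finperm1 finpermM.
Proof. by move=> s; apply: finpermP => x; rewrite finpermME finperm1E. Qed.
Fact finperm_mulr1 : right_id finperm1 finpermM.
Proof. by move=> s; apply: finpermP => x; rewrite finpermME finperm1E. Qed.
Fact finperm_mulV : left_inverse finperm1 finpermV finpermM.
Proof.
by move=> s; apply: finpermP => x; rewrite finpermME finperm1E; apply: finpermV_valK.
Qed.
Fact finperm_mulrV : right_inverse finperm1 finpermV finpermM.
Proof.
by move=> s; apply: finpermP => x; rewrite finpermME finperm1E; apply: finpermV_valKV.
Qed.

HB.instance Definition _ := isGroup.Build finPerm
  finpermA finperm_mul1 finperm_mulr1 finperm_mulV finperm_mulrV.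

End FinPermGroup.

(* insubd turns the finitely supported map "next in the cyclic sequence s" into
   a permutation; it defaults to the identity when s has repetitions, see
   finperm_cycleE for the duplicate-free case *)
Definition finperm_cycle (s : seq nat) : finPerm :=
  insubd (1%g : finPerm) [fsfun x in [fset y | y in s]%fset => next s x].

Lemma finperm_cycleE (s : seq nat) : uniq s -> finperm_cycle s =1 next s.
Proof.
move=> us x; rewrite /finperm_cycle; set f := (X in insubd _ X).
have fE : f =1 next s.
  move=> y; rewrite [LHS]fsfun_fun !inE /=; case: ifPn => // ys.
  by rewrite next_nth (negPf ys).
have fb : `[< bijective f >].
  apply/asboolP; exists (prev s) => y; rewrite fE.
    exact: prev_next.
  exact: next_prev.
by rewrite -[LHS]/(val (insubd (1%g : finPerm) f) x) insubdK.
Qed.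

Lemma finperm_cycleV (x : nat) (s : seq nat) : uniq (x :: s) ->
  (finperm_cycle (x :: s))^-1%g = finperm_cycle (x :: rev s).
Proof.
move=> us; have us' : uniq (x :: rev s) by rewrite /= mem_rev rev_uniq.
apply: (mulgI (finperm_cycle (x :: s))); rewrite mulgV.
apply: finpermP => y; rewrite [LHS]finperm1E [RHS]finpermME !finperm_cycleE //.
have -> : x :: rev s = rotr 1 (rev (x :: s)) by rewrite rev_cons rotr1_rcons.
by rewrite next_rotr ?rev_uniq // next_rev // next_prev.
Qed.

(* The group algebra K[G].  The ring structure of monalg is only available for
   monoids whose sole invertible element is 1, hence the alias of the free
   module {malg K[G]} on which the convolution product is put. *)
Definition groupAlg (K : comNzRingType) (G : groupType) := {malg K[G]}.

Section GroupAlg.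
Context (K : comNzRingType) (G : groupType).
Local Notation KG := (groupAlg K G).
Implicit Types (x y z : KG) (a b c : K) (g h : G).

HB.instance Definition _ := GRing.Lmodule.copy KG {malg K[G]}.

Definition gamul x y : KG :=
  \sum_(g <- msupp x) \sum_(h <- msupp y) << x@_g * y@_h *g (g * h)%g >>.

Definition gaone : KG := << 1%g >>.

Lemma gamulE (A B : {fset G}) x y :
  (msupp x `<=` A)%fset -> (msupp y `<=` B)%fset ->
  gamul x y = \sum_(g <- A) \sum_(h <- B) << x@_g * y@_h *g (g * h)%g >>.
Proof.
move=> xA yB; rewrite /gamul (big_fset_incl _ xA) /=.
  apply/eq_bigr => g _; apply/big_fset_incl => // h _ /mcoeff_outdom ->.
  by rewrite mulr0 monalgU0.
move=> g _ /mcoeff_outdom xg.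
by rewrite big1 // => h _; rewrite xg mul0r monalgU0.
Qed.

Lemma gamulDl : left_distributive gamul +%R.
Proof.
move=> x y z; pose A := (msupp x `|` msupp y)%fset.
rewrite !(@gamulE A (msupp z)) ?fsubsetUl ?fsubsetUr ?fsubset_refl ?msuppD_le //.
rewrite -big_split /=; apply/eq_bigr => g _.
rewrite -big_split /=; apply/eq_bigr => h _.
by rewrite mcoeffD mulrDl monalgUD.
Qed.

Lemma gamulDr : right_distributive gamul +%R.
Proof.
move=> x y z; pose A := (msupp y `|` msupp z)%fset.
rewrite !(@gamulE (msupp x) A) ?fsubsetUl ?fsubsetUr ?fsubset_refl ?msuppD_le //.
rewrite -big_split /=; apply/eq_bigr => g _.
rewrite -big_split /=; apply/eq_bigr => h _.
by rewrite mcoeffD mulrDr monalgUD.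
Qed.

Lemma gamul0l : left_zero 0 gamul.
Proof. by move=> x; rewrite /gamul msupp0 big_seq_fset0. Qed.

Lemma gamul0r : right_zero 0 gamul.
Proof.
by move=> x; rewrite /gamul big1 // => g _; rewrite msupp0 big_seq_fset0.
Qed.

Lemma gamulUU a b g h :
  gamul << a *g g >> << b *g h >> = << a * b *g (g * h)%g >>.
Proof.
by rewrite (gamulE msuppU_le msuppU_le) !big_seq_fset1 !mcoeffUU.
Qed.

Lemma gamul_suml (I : Type) (r : seq I) (F : I -> KG) y :
  gamul (\sum_(i <- r) F i) y = \sum_(i <- r) gamul (F i) y.
Proof. exact: (big_morph (gamul^~ y) (fun _ _ => gamulDl _ _ _) (gamul0l _)). Qed.

Lemma gamul_sumr (I : Type) (r : seq I) (F : I -> KG) x :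
  gamul x (\sum_(i <- r) F i) = \sum_(i <- r) gamul x (F i).
Proof. exact: (big_morph (gamul x) (fun _ _ => gamulDr _ _ _) (gamul0r _)). Qed.

Lemma gaE x : x = \sum_(g <- msupp x) (<< x@_g *g g >> : KG).
Proof. exact: monalgE. Qed.

Lemma gamulA : associative gamul.
Proof.
move=> x y z; rewrite [x]gaE [y]gaE [z]gaE.
rewrite !gamul_suml; apply: eq_bigr => g _.
rewrite !(gamul_sumr _ _ (<< x@_g *g g >> : KG)) gamul_suml.
apply: eq_bigr => h _; rewrite !gamul_sumr; apply: eq_bigr => k _.
by rewrite !gamulUU mulrA mulgA.
Qed.

Lemma gamul1l : left_id gaone gamul.
Proof.
move=> x; rewrite [x]gaE gamul_sumr; apply: eq_bigr => g _.
by rewrite gamulUU mul1r mul1g.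
Qed.

Lemma gamul1r : right_id gaone gamul.
Proof.
move=> x; rewrite [x]gaE gamul_suml; apply: eq_bigr => g _.
by rewrite gamulUU mulr1 mulg1.
Qed.

Lemma gaone_neq0 : gaone != 0.
Proof. by rewrite monalgU_eq0 oner_eq0. Qed.

HB.instance Definition _ := GRing.Zmodule_isNzRing.Build KG
  gamulA gamul1l gamul1r gamulDl gamulDr gaone_neq0.

Lemma gaZU a b g : a *: (<< b *g g >> : KG) = << a * b *g g >>.
Proof. by apply/malgP => h; rewrite mcoeffZ !mcoeffU mulrnAr. Qed.

Lemma gascaleAl a x y : a *: (x * y) = (a *: x) * y.
Proof.
rewrite -![_ * _]/(gamul _ _).
rewrite (gamulE (msuppZ_le a x) (fsubset_refl (msupp y))) /gamul scaler_sumr.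
apply: eq_bigr => g _; rewrite scaler_sumr; apply: eq_bigr => h _.
by rewrite gaZU mcoeffZ mulrA.
Qed.

HB.instance Definition _ := GRing.Lmodule_isLalgebra.Build K KG gascaleAl.

Lemma gascaleAr a x y : a *: (x * y) = x * (a *: y).
Proof.
rewrite -![_ * _]/(gamul _ _).
rewrite (gamulE (fsubset_refl (msupp x)) (msuppZ_le a y)) /gamul scaler_sumr.
apply: eq_bigr => g _; rewrite scaler_sumr; apply: eq_bigr => h _.
by rewrite gaZU mcoeffZ mulrCA.
Qed.

HB.instance Definition _ := GRing.Lalgebra_isAlgebra.Build K KG gascaleAr.

End GroupAlg.

Record ncProbSpace (R : realType) := NCProbSpace {
  ncalg :> algType R[i];
  star : ncalg -> ncalg;
  state : {scalar ncalg};
  starD : forall x y, star (x + y) = star x + star y;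
  starZ : forall (c : R[i]) x, star (c *: x) = c^* *: star x;
  starM : forall x y, star (x * y) = star y * star x;
  starK : involutive star;
  state1 : state 1 = 1;
  state_star : forall x, state (star x) = (state x)^*;
  state_ge0 : forall x, 0 <= state (x * star x) }.

Arguments star {R n}.
Arguments state {R n}.

Definition self_adjoint (R : realType) (A : ncProbSpace R) (x : A) : Prop :=
  star x = x.

Section GroupAlgNC.
Context (R : realType) (G : groupType).
Local Notation CG := (groupAlg R[i] G).
Implicit Types (x y : CG) (g h : G).

Definition gastar x : CG := \sum_(g <- msupp x) << (x@_g)^* *g g^-1%g >>.

Definition gatrace x : R[i] := x@_(1%g).

Lemma gastarE x g : (gastar x)@_g = (x@_(g^-1)%g)^*.
Proof.
rewrite raddf_sum /=; under eq_bigr do rewrite mcoeffU.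
have [gx|gx] := msuppP x (g^-1)%g.
  rewrite (big_fsetD1 _ gx) /= invgK eqxx mulr1n big1_fset ?addr0 // => h.
  rewrite in_fsetD1 => /andP[hg _] _; case: eqP => // /(congr1 (fun k : G => k^-1)%g).
  by rewrite invgK => /eqP; rewrite (negPf hg).
rewrite rmorph0 big1_fset // => h hx _; case: eqP => // hg.
by move: gx; rewrite -hg invgK hx.
Qed.

Fact gastarD x y : gastar (x + y) = gastar x + gastar y.
Proof. by apply/malgP => g; rewrite mcoeffD !gastarE mcoeffD rmorphD. Qed.

Fact gastarZ (c : R[i]) x : gastar (c *: x) = c^* *: gastar x.
Proof. by apply/malgP => g; rewrite mcoeffZ !gastarE mcoeffZ rmorphM. Qed.

Lemma gastarU (c : R[i]) g : gastar << c *g g >> = << c^* *g g^-1%g >>.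
Proof.
apply/malgP => h; rewrite gastarE !mcoeffU rmorphMn; congr (_ *+ nat_of_bool _).
by rewrite (can2_eq (@invgK G) (@invgK G)).
Qed.

Lemma gastar_sum (I : Type) (r : seq I) (P : pred I) (F : I -> CG) :
  gastar (\sum_(i <- r | P i) F i) = \sum_(i <- r | P i) gastar (F i).
Proof.
apply: (big_morph gastar gastarD).
by apply/malgP => g; rewrite gastarE !mcoeff0 rmorph0.
Qed.

Fact gastarM x y : gastar (x * y) = gastar y * gastar x.
Proof.
rewrite [x]gaE [y]gaE mulr_suml !gastar_sum [RHS]mulr_sumr.
apply: eq_bigr => g _; rewrite mulr_sumr gastar_sum [RHS]mulr_suml.
apply: eq_bigr => h _; rewrite !gastarU.
by rewrite -![_ * _]/(gamul _ _) !gamulUU gastarU invgM rmorphM mulrC.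
Qed.

Fact gastarK : involutive gastar.
Proof. by move=> x; apply/malgP => g; rewrite !gastarE invgK conjCK. Qed.

Fact gatrace_linear : scalar gatrace.
Proof. by move=> c x y; rewrite /gatrace mcoeffD mcoeffZ. Qed.

HB.instance Definition _ :=
  GRing.isLinear.Build R[i] CG R[i] *%R gatrace gatrace_linear.

Fact gatrace1 : gatrace 1 = 1.
Proof. exact: mcoeffUU. Qed.

Fact gatrace_star x : gatrace (gastar x) = (gatrace x)^*.
Proof. by rewrite /gatrace gastarE invg1. Qed.

Fact gatrace_ge0 x : 0 <= gatrace (x * gastar x).
Proof.
rewrite {2}[x]gaE gastar_sum mulr_sumr /gatrace raddf_sum /=.
apply: sumr_ge0 => g _; rewrite gastarU {1}[x]gaE mulr_suml raddf_sum /=.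
apply: sumr_ge0 => h _; rewrite -[_ * _]/(gamul _ _) gamulUU mcoeffU.
have [hg|_] := eqVneq (h * g^-1)%g 1%g; last by rewrite mulr0n.
rewrite (divg1_eq hg).
by rewrite mulr1n mul_conjC_ge0.
Qed.

Definition groupAlgNC : ncProbSpace R :=
  @NCProbSpace R CG gastar gatrace gastarD gastarZ gastarM gastarK
    gatrace1 gatrace_star gatrace_ge0.

End GroupAlgNC.

Section Distributions.
Context (R : realType).

(* polynomials in non-commuting variables: the algebra of the free monoid *)
Definition ncPoly (I : choiceType) := {malg R[i][{fmonom I}]}.

Definition nc_eval (A : ncProbSpace R) (I : choiceType) (x : I -> A)
    (P : ncPoly I) : A :=
  mmap (in_alg A) (fun m : {fmonom I} => \prod_(i <- m) x i) P.

Definition nc_distribution (A : ncProbSpace R) (I : choiceType) (x : I -> A)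
    (P : ncPoly I) : R[i] :=
  state (nc_eval x P).

Definition cvg_distribution (A B : ncProbSpace R) (I : choiceType)
    (x : nat -> I -> A) (y : I -> B) : Prop :=
  forall P : ncPoly I,
    (fun n => nc_distribution (x n) P) @ \oo --> (nc_distribution y P : R[i]^o).

Definition unital_subalg (A : ncProbSpace R) (x : A) : set A :=
  range (horner_alg x).

Definition free_family (A : ncProbSpace R) (I : eqType) (B : I -> set A) : Prop :=
  forall s : seq (I * A), s != [::] ->
    sorted (fun u v => u.1 != v.1) s ->
    (forall u, u \in s -> B u.1 u.2 /\ state u.2 = 0) ->
    state (\prod_(u <- s) u.2) = 0.

Definition semicircle_density (s : R) : R := Num.sqrt (4 - s ^+ 2) / (2 * pi).

(* The centered semicircle law of variance t is the image of the standard one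
   under s |-> sqrt t * s; it is the Dirac mass at 0 when t = 0. *)
Definition semicircular (A : ncProbSpace R) (t : R) (x : A) : Prop :=
  self_adjoint x /\
  forall k : nat, state (x ^+ k) =
    (\int[lebesgue_measure]_(s in `[(-2)%R, 2%R])
       ((Num.sqrt t * s) ^+ k * semicircle_density s))%:C.

Definition increment (A : ncProbSpace R) (S : R -> A) (t : nat -> R) (i : nat) : A :=
  if i is j.+1 then S (t j.+1) - S (t j) else S (t 0%N).

(* For self-adjoint x, unital_subalg x is the unital *-algebra generated by x.
   As usual the initial value is counted among the increments. *)
Definition free_increments (A : ncProbSpace R) (S : R -> A) : Prop :=
  forall (k : nat) (t : nat -> R), 0 <= t 0%N ->
    (forall i, (i < k)%N -> t i < t i.+1) ->
    free_family (fun i : 'I_k.+1 => unital_subalg (increment S t i)).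

(* A process (S_t), t in [0, +oo[, is represented by a function on R whose
   values at negative times are irrelevant. *)
Definition free_brownian_motion (A : ncProbSpace R) (S : R -> A) : Prop :=
  free_increments S /\ forall t : R, 0 <= t -> semicircular t (S t).

End Distributions.

Section Chebyshev.
Context (K : comNzRingType).

Fixpoint chebyshevU (n : nat) : {poly K} :=
  match n with
  | 0 => 1
  | m.+1 => if m is k.+1 then 'X * chebyshevU m - chebyshevU k else 'X
  end.

(* The polynomial t^(r/2) U_r(t^(-1/2) x) in x and t: the coefficient of x^k in
   U_r vanishes unless r - k is even and nonnegative. *)
Definition scaled_chebyshevU (r : nat) (t : K) : {poly K} :=
  \poly_(k < r.+1) ((chebyshevU r)`_k * t ^+ (r - k)./2).

End Chebyshev.

Lemma chebyshevU_coef0 (K : comNzRingType) (n k : nat) :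
  (n < k)%N || odd (n + k) -> (chebyshevU K n)`_k = 0.
Proof.
elim/ltn_ind: n k => -[|[|n]] IHn k.
- by rewrite /= coef1; case: k.
- by rewrite /= coefX; case: k => [|[|k]].
rewrite [chebyshevU K n.+2]/('X * chebyshevU K n.+1 - chebyshevU K n) => nk.
rewrite coefB coefXM; case: k nk => [|k] nk /=.
  by rewrite IHn ?subr0 //; move: nk; rewrite /= !addn0 negbK.
have nk1 : (n.+1 < k)%N || odd (n.+1 + k).
  by move: nk; rewrite ltnS !addSn addnS /= negbK.
have nk2 : (n < k.+1)%N || odd (n + k.+1).
  case/orP: nk => [nk|]; first by rewrite (ltn_trans (leqnSn n.+1) nk).
  by rewrite !addSn addnS /= negbK => ->; rewrite orbT.
by rewrite (IHn n.+1) // (IHn n) ?subr0 // leqW.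
Qed.

Lemma scaled_chebyshevUE (R : realType) (r : nat) (t : R) : 0 < t ->
  scaled_chebyshevU r t =
  Num.sqrt t ^+ r *: (chebyshevU R r \Po ((Num.sqrt t)^-1 *: 'X)).
Proof.
move=> t0; have s0 : Num.sqrt t != 0 by rewrite sqrtr_eq0 -ltNge.
apply/polyP => k; rewrite coef_poly coefZ comp_polyE coef_sum.
under eq_bigr do rewrite coefZ exprZn coefZ coefXn.
have -> : \sum_(i < size (chebyshevU R r))
    (chebyshevU R r)`_i * ((Num.sqrt t)^-1 ^+ i * (k == i)%:R) =
    (chebyshevU R r)`_k * (Num.sqrt t)^-1 ^+ k.
  have [kr|kr] := ltnP k (size (chebyshevU R r)).
    rewrite (bigD1 (Ordinal kr)) //= eqxx mulr1 big1 ?addr0 // => i.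
    rewrite -val_eqE /= => ik; rewrite [k == i]eq_sym (negPf ik) !mulr0 //.
  rewrite nth_default // mul0r big1 // => i _.
  by rewrite gtn_eqF ?mulr0 // (leq_trans _ kr).
rewrite ltnS; case: leqP => [kr|rk]; last first.
  by rewrite chebyshevU_coef0 ?rk // !mul0r mulr0.
have [odd_rk|even_rk] := boolP (odd (r + k)).
  by rewrite chebyshevU_coef0 ?odd_rk ?orbT // !mul0r mulr0.
rewrite mulrCA; congr (_ * _).
have e : (r - k = (r - k)./2.*2)%N.
  by rewrite -[LHS]odd_double_half oddB // -oddD (negPf even_rk).
rewrite -{1}(sqr_sqrtr (ltW t0)) -exprM mulnC muln2 -e.
by rewrite exprB ?unitfE // exprVn.
Qed.

Section LongCycles.
Context (R : realType).

Definition CS : ncProbSpace R := groupAlgNC R finPerm.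

Definition Mcycles (r n : nat) (t : R) : CS :=
  let N := Num.truncn (n%:R * t) in
  ((n%:R `^ (r%:R / 2))^-1)%:C *:
    \sum_(a : r.-tuple 'I_N.+1 | uniq a && all (fun i : 'I_N.+1 => (0 < i)%N) a)
      << finperm_cycle (0%N :: [seq val i | i <- a]) >>.

Lemma Mcycles_self_adjoint (r n : nat) (t : R) : self_adjoint (Mcycles r n t).
Proof.
rewrite /self_adjoint /Mcycles; set N := Num.truncn _; set c := (_ `^ _)^-1.
rewrite [LHS]gastarZ [X in X *: _](_ : _ = c%:C); last first.
  by apply/eqP; rewrite eq_complex /= oppr0 !eqxx.
congr (_ *: _); rewrite [LHS]gastar_sum.
pose f (a : r.-tuple 'I_N.+1) : r.-tuple 'I_N.+1 := [tuple of rev a].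
have fK : involutive f by move=> a; apply/val_inj; rewrite /= revK.
rewrite [RHS](reindex_inj (inv_inj fK)); apply: eq_big => [a|a /andP[ua a0]].
  by rewrite /= rev_uniq all_rev.
rewrite [LHS]gastarU rmorph1 finperm_cycleV ?map_rev //.
rewrite /= (map_inj_uniq val_inj) ua andbT.
by apply/mapP => -[i ia i0]; move/allP: a0 => /(_ i ia); rewrite -i0.
Qed.

Definition cycleIndex := {p : nat * R | (0 < p.1)%N && (0 <= p.2)}.

End LongCycles.

(* Main.v *)
(* The cycle (0 a_r ... a_1) is the product of the star transpositions (0 a_i),
   so a moment of the M_r(n,t) is n^(-k/2) times the number of words in these
   transpositions, subject to constraints, whose product is the identity.  In
   such a word every letter occurs at least twice, hence the words with a letter
   occurring three times are O(n^((k-1)/2)) many; in the other ones a letter x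
   can only cancel against an adjacent x (bad_word_count).  Up to
   terms that vanish in every moment, left multiplication by M_1(n,t) therefore
   acts on sums of cycles as creation plus annihilation operators on a full Fock
   space with covariance min(s,t) (letter_mul_cycle_sum).  The limit state is
   the vacuum state on the free algebra; it is positive as a limit of states.
   Wick ordering gives the freeness of the increments, and turns
   t^(r/2) U_r(t^(-1/2) X_t) into the r-th tensor power of the letter t, which
   has vacuum expectation 0 for r > 0.  This determines the moments of X_t, as
   U_r also integrates to 0 against the semicircle density. *)
Require Import Defs.
From HB Require Import structures.
From mathcomp Require Import all_boot all_order all_algebra.
From mathcomp Require Import finmap monalg complex.
From mathcomp Require Import all_classical all_reals all_analysis.
From mathcomp Require Import zify ring lra.
Import Order.TTheory GRing.Theory Num.Theory numFieldNormedType.Exports.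
Local Open Scope complex_scope.
Local Open Scope ring_scope.
Set Implicit Arguments.
Unset Strict Implicit.
Unset Printing Implicit Defensive.

(** * Words in star transpositions *)

Section StarWords.
Local Open Scope nat_scope.
Implicit Types (a x y : nat) (p q u v w : seq nat).

Definition starw w : finPerm := foldr (fun a g => (finperm_cycle [:: 0; a] * g)%g) 1%g w.

Lemma starw_cat u v : starw (u ++ v) = (starw u * starw v)%g.
Proof. by elim: u => [|a u IH] /=; rewrite ?mul1g // IH mulgA. Qed.

Lemma star_transpE a x : a != 0 ->
  finperm_cycle [:: 0; a] x = if x == 0 then a else if x == a then 0 else x.
Proof.
move=> a0; rewrite finperm_cycleE; last by rewrite /= inE eq_sym a0.
by rewrite /=; do !case: eqVneq => //; move=> -> ?; subst.
Qed.

Lemma star_transp0 a : a != 0 -> finperm_cycle [:: 0; a] 0 = a.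
Proof. by move=> a0; rewrite star_transpE. Qed.

Lemma star_transpR a : a != 0 -> finperm_cycle [:: 0; a] a = 0.
Proof. by move=> a0; rewrite star_transpE // (negPf a0) eqxx. Qed.

Lemma star_transpK a : a != 0 ->
  (finperm_cycle [:: 0; a] * finperm_cycle [:: 0; a])%g = 1%g.
Proof.
move=> a0; apply: finpermP => x; rewrite [LHS]finpermME [RHS]finperm1E.
rewrite (star_transpE x) //; have [->|x0] := eqVneq x 0; first by rewrite star_transpR.
have [->|xa] := eqVneq x a; first by rewrite star_transp0.
by rewrite star_transpE // (negPf x0) (negPf xa).
Qed.

Lemma starw_cons a w x : starw (a :: w) x = finperm_cycle [:: 0; a] (starw w x).
Proof. exact: finpermME. Qed.

Lemma starw_catE u v x : starw (u ++ v) x = starw u (starw v x).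
Proof. by rewrite starw_cat; exact: finpermME. Qed.

Lemma starw_fix w x : 0 \notin w -> x != 0 -> x \notin w -> starw w x = x.
Proof.
move=> w0 x0; elim: w w0 => [|a w IH] /=; first by rewrite finperm1E.
rewrite !inE !negb_or => /andP[a0 w0] /andP[xa xw].
by rewrite eq_sym in a0; rewrite starw_cons IH // star_transpE // (negPf x0) (negPf xa).
Qed.

Lemma starw1_count w x : 0 \notin w -> starw w = 1%g -> x \in w -> 1 < count_mem x w.
Proof.
move=> w0 w1 xw; rewrite ltnNge; apply/negP => c1.
have x0 : x != 0 by apply: contraNneq w0 => <-.
case/splitPr: xw w0 w1 c1 => u v w0 w1 c1.
have : starw (u ++ x :: v) x = x by rewrite w1 finperm1E.
move: c1 w0; rewrite count_cat /= eqxx add1n mem_cat inE !negb_or => c1 /and3P[u0 _ v0].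
move: c1; rewrite addnS ltnS leqn0 addn_eq0 => /andP[/eqP/count_memPn xu /eqP/count_memPn xv].
rewrite starw_catE starw_cons (starw_fix v0 x0 xv) star_transpR //.
move=> ux; have ux' := starw_fix u0 x0 xu.
have /bij_inj/(_ 0 x) := finperm_bij (starw u).
by rewrite ux ux' => /(_ erefl) e; rewrite -e in x0.
Qed.

(* An occurrence x q x in which q ends with a letter that cannot cancel in q. *)
Definition bad_word w := exists p x q y r,
  [/\ w = p ++ x :: rcons q y ++ x :: r, y \notin q & y != x].

(* If x occurred only twice, starw w would send x to 0, then to y, and y would
   have to be sent to x by the letters to the left of the first x. *)
Lemma bad_word_count u v w : 0 \notin u ++ w ++ v -> bad_word w ->
  starw (u ++ w ++ v) = 1%g -> exists x, 2 < count_mem x (u ++ w ++ v).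
Proof.
move=> w0 [p [x [q [y [r [E yq yx]]]]]] w1; exists x.
have {}E : u ++ w ++ v = (u ++ p) ++ x :: rcons q y ++ x :: (r ++ v).
  by rewrite E -!catA /= -!catA.
move: w0 w1; rewrite E; move: (u ++ p) (r ++ v) => {u v p r w E} u v.
rewrite ltnNge => w0 w1; apply/negP => c2.
have : starw (u ++ x :: rcons q y ++ x :: v) x = x by rewrite w1 finperm1E.
move: c2; rewrite count_cat /= count_cat /= eqxx !add1n => c2.
move: w0; rewrite mem_cat in_cons (mem_cat 0 (rcons q y)) mem_rcons !in_cons !negb_or.
case/and5P => u0 x0 /andP[y0 q0] _ v0.
move: c2; rewrite !addnS !ltnS leqn0 !addn_eq0.
case/and3P=> /eqP/count_memPn xu _ /eqP/count_memPn xv.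
rewrite eq_sym in x0; rewrite eq_sym in y0.
rewrite starw_catE starw_cons starw_catE starw_cons (starw_fix v0 x0 xv).
rewrite (star_transpR x0) -cats1 starw_catE starw_cons finperm1E.
rewrite (star_transp0 y0) (starw_fix q0 y0 yq) star_transpE // (negPf y0) (negPf yx).
move=> uy; have ux := starw_fix u0 x0 xu.
have /bij_inj/(_ y x) := finperm_bij (starw u).
by rewrite uy ux => /(_ erefl) e; rewrite e eqxx in yx.
Qed.

Lemma starw_uniq_neq1 w : 0 \notin w -> uniq w -> w != [::] -> starw w <> 1%g.
Proof.
case: w => // a w w0 uw _ w1.
by have := starw1_count w0 w1 (mem_head a w); rewrite count_uniq_mem ?mem_head.
Qed.

(** The rightmost letter acts first, so left multiplication by the transposition (0 b) makes [b] the
    last entry of the cycle: the former last entry now goes to [b], and [b] to 0. Hence the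
    reversal. *)
Lemma finperm_cycle_starw w : 0 \notin w -> uniq w ->
  starw w = finperm_cycle (0 :: rev w).
Proof.
elim: w => [|b w IH] w0 uw.
  by apply: finpermP => x; rewrite finperm_cycleE // finperm1E /=; case: eqP.
move: w0 uw; rewrite inE negb_or /= => /andP[b0 w0] /andP[bw uw].
apply: finpermP => x; rewrite starw_cons IH // rev_cons.
rewrite [RHS]finperm_cycleE; last first.
  by rewrite cons_uniq mem_rcons in_cons negb_or mem_rev b0 w0 rcons_uniq mem_rev bw rev_uniq.
rewrite (finperm_cycleE (_ : uniq (0 :: rev w))); last by rewrite cons_uniq mem_rev w0 rev_uniq.
rewrite eq_sym in b0; rewrite star_transpE //.
rewrite -(mem_rev w) in bw; rewrite -(mem_rev w) in w0.
move: (rev w) w0 bw => s s0 bs.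
rewrite !next_nth !in_cons mem_rcons in_cons.
have [->|x0] /= := eqVneq x 0.
  case: s s0 bs => [|c s] //=.
  by rewrite !in_cons !negb_or => /andP[/negPf c0 _] /andP[/negPf cb _]; rewrite eq_sym c0 eq_sym cb.
have [-> /=|xb /=] := eqVneq x b.
  rewrite (negPf bs) (negPf b0) eqxx [0 == b]eq_sym (negPf b0).
  rewrite -cats1 index_cat (negPf bs) /= eqxx addn0.
  by rewrite nth_default // size_cat /= addn1.
have [xs|xs] := boolP (x \in s); last by rewrite (negPf x0) (negPf xb).
rewrite [0 == x]eq_sym (negPf x0) -cats1 index_cat xs.
have ltx : index x s < size s by rewrite index_mem.
rewrite nth_cat.
have [lt|ge] := ltnP (index x s).+1 (size s).
  have m : nth 0 s (index x s).+1 \in s by rewrite mem_nth.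
  case: eqP => [e|_]; first by rewrite e (negPf s0) in m.
  by case: eqP => [e|//]; rewrite e (negPf bs) in m.
have -> : (index x s).+1 = size s by lia.
by rewrite nth_default //= subnn.
Qed.

(** * Counting distinct letters, and words with few of them *)

Lemma size_sum_count w : size w = \sum_(x <- undup w) count_mem x w.
Proof.
rewrite -{1}(perm_size (perm_count_undup w)) size_flatten /shape -map_comp sumnE big_map.
by apply: eq_bigr => x _; rewrite /= size_nseq.
Qed.

Lemma starw1_undup w : 0 \notin w -> starw w = 1%g -> (size (undup w)).*2 <= size w.
Proof.
move=> w0 w1; rewrite (size_sum_count w) -muln2 -sum1_size big_distrl /= big_seq [leqRHS]big_seq.
by apply: leq_sum => x; rewrite mem_undup => /(starw1_count w0 w1).
Qed.

(** One letter occurs three times and every other one at least twice, whence the strict inequality.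
    It costs half a power of n in the count, which makes bad words negligible. *)
Lemma bad_word_undup u v w : 0 \notin u ++ w ++ v -> bad_word w ->
  starw (u ++ w ++ v) = 1%g -> (size (undup (u ++ w ++ v))).*2 < size (u ++ w ++ v).
Proof.
move=> w0 bw w1; have [x] := bad_word_count w0 bw w1.
move: (u ++ w ++ v) w0 w1 => {bw u v} z z0 z1 c3.
have xz : x \in undup z by rewrite mem_undup -has_pred1 has_count; lia.
rewrite (size_sum_count z) (big_rem x) //= -muln2 -sum1_size (big_rem x) //= mulnDl.
rewrite big_distrl /= -ltnS -addSn; apply: (@leq_add 3) => //.
rewrite big_seq [leqRHS]big_seq; apply: leq_sum => y /mem_rem; rewrite mem_undup.
exact: starw1_count.
Qed.

Fixpoint words (Ns : seq nat) : seq (seq nat) :=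
  if Ns is N :: Ns' then [seq a :: w | a <- iota 1 N, w <- words Ns'] else [:: [::]].

Lemma size_words Ns w : w \in words Ns -> size w = size Ns.
Proof.
elim: Ns w => [|N Ns IH] w /=; first by rewrite inE => /eqP->.
by case/allpairsP => -[a v] /= [_ /IH sv ->] /=; rewrite sv.
Qed.

Lemma words0 Ns w : w \in words Ns -> 0 \notin w.
Proof.
elim: Ns w => [|N Ns IH] w /=; first by rewrite inE => /eqP->.
case/allpairsP => -[a v] /= [aN /IH sv ->] /=; rewrite inE negb_or sv andbT.
by move: aN; rewrite mem_iota; case: a.
Qed.

Lemma words_uniq Ns : uniq (words Ns).
Proof.
elim: Ns => //= N Ns IH; apply: allpairs_uniq => //; first exact: iota_uniq.
by move=> [a v] [b w] _ _ /= [-> ->].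
Qed.

Lemma mem_words Ns w :
  (w \in words Ns) = all2 (fun a N => 0 < a <= N) w Ns.
Proof.
elim: Ns w => [|N Ns IH] [|a w] //=; first by apply/allpairsP => -[[]? ?] [].
apply/allpairsP/andP => [[[b v]] /= [bN vw [-> ->]]|[aN vw]].
  by split; [move: bN; rewrite mem_iota; lia | rewrite -IH].
by exists (a, w); split=> //=; [rewrite mem_iota; lia | rewrite IH].
Qed.

Lemma words_cat (V : nmodType) Ns Ns' (F : seq nat -> V) :
  (\sum_(w <- words (Ns ++ Ns')) F w =
   \sum_(u <- words Ns) \sum_(v <- words Ns') F (u ++ v))%R.
Proof.
elim: Ns F => [|N Ns IH] F /=; first by rewrite big_seq1.
by rewrite !big_allpairs_dep; apply: eq_bigr => a _; rewrite IH.
Qed.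

Lemma words_widen (V : nmodType) Ns Ns' (F : seq nat -> V) :
  all2 leq Ns Ns' ->
  (\sum_(w <- words Ns) F w = \sum_(w <- words Ns' | w \in words Ns) F w)%R.
Proof.
move=> le; rewrite -[RHS]big_filter; apply: perm_big.
rewrite uniq_perm ?filter_uniq ?words_uniq // => w.
rewrite mem_filter; case: (boolP (w \in words Ns)) => //=.
rewrite !mem_words; elim: Ns Ns' w le => [|N Ns IH] [|N' Ns'] [|a w] //=.
move=> /andP[NN le] /andP[aN /(IH Ns' w le) <-]; rewrite andbT; lia.
Qed.

Definition count_words k N m := count (fun w => size (undup w) <= m) (words (nseq k N)).

(** Induction on the length: either the tail has at most m distinct letters and the head is one of
    N, or the tail has m + 1 of them and the head is one of these, hence one of at most k. *)
Lemma count_words_le k N m : 0 < N -> count_words k N m <= k`! * N ^ m.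
Proof.
rewrite /count_words => N0.
elim: k m => [|k IH] [|m] //=.
- by rewrite fact0 mul1n addn0 expn_gt0 N0.
- rewrite (@eq_in_count _ _ pred0) ?count_pred0 // => w /allpairsP[[a v] [_ _ ->]] /=.
  by case: ifP => //; rewrite -mem_undup; case: (undup v).
have eb T (P : pred T) (s : seq T) : \sum_(i <- s) P i = count P s.
  by rewrite -sum1_count [RHS]big_mkcond; apply: eq_bigr => i _; case: (P i).
rewrite -eb big_allpairs_dep /= exchange_big /=.
apply: (@leq_trans (\sum_(w <- words (nseq k N))
    ((size (undup w) <= m) * N + (size (undup w) <= m.+1) * k))).
  rewrite big_seq [leqRHS]big_seq; apply: leq_sum => w /size_words sw.
  rewrite eb.
  have [wm|wm] := leqP (size (undup w)) m.
    by rewrite mul1n (leq_trans (count_size _ _)) // size_iota leq_addr.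
  rewrite mul0n add0n; have [wm'|wm'] := leqP (size (undup w)) m.+1.
    rewrite mul1n; rewrite size_nseq in sw.
    apply: (@leq_trans (size (undup w))); last by rewrite -sw size_undup.
    rewrite -size_filter; apply: uniq_leq_size; first exact: filter_uniq (iota_uniq _ _).
    move=> a; rewrite mem_filter mem_undup; apply: contraTT => /negPf->.
    by rewrite /= ltnS leqNgt wm.
  rewrite mul0n leqn0; apply/eqP; rewrite (@eq_count _ _ pred0) ?count_pred0 // => a /=.
  by apply/negbTE; rewrite -ltnNge; case: ifP => _ //=; rewrite ltnS ltnW.
rewrite big_split /= -!big_distrl /=.
rewrite !eb factS expnS.
apply: leq_trans (leq_add (leq_mul (IH m) (leqnn N)) (leq_mul (IH m.+1) (leqnn k))) _.
by rewrite expnS; move: (k`!) (N ^ m) => x y; nia.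
Qed.

End StarWords.

(** * Normalized sums over words *)

Section WordSums.
Context (R : realType).
Local Notation KG := (groupAlg R[i] finPerm).
Implicit Types (n k l N K : nat) (f g : seq nat -> R[i]) (x y z : nat -> KG).

Lemma gaUU (a b : R[i]) (g h : finPerm) :
  (<< a *g g >> : KG) * << b *g h >> = << a * b *g (g * h)%g >>.
Proof. exact: gamulUU. Qed.

Definition rsqrt n : R[i] := ((Num.sqrt (n%:R : R))^-1)%:C.

Lemma rsqrt_ge0 n : 0 <= rsqrt n.
Proof. by rewrite /rsqrt ler0c invr_ge0 sqrtr_ge0. Qed.

Lemma rsqrt_sqr n : (0 < n)%N -> n%:R * rsqrt n ^+ 2 = 1.
Proof.
move=> n0; rewrite /rsqrt -rmorphXn /= exprVn sqr_sqrtr ?ler0n //.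
by rewrite -(rmorph_nat (real_complex R)) -rmorphM /= divff ?rmorph1 // pnatr_eq0 -lt0n.
Qed.

Lemma rsqrt_le1 n : rsqrt n <= 1.
Proof.
case: n => [|n]; first by rewrite /rsqrt sqrtr0 invr0 ler01.
rewrite -[1]/(1%:C) /rsqrt lecR invf_le1 ?sqrtr_gt0 ?ltr0n //.
by rewrite -{1}[1]sqrtr1 ler_wsqrtr // ler1n.
Qed.

Definition wsum Ns f : KG := \sum_(w <- words Ns) << f w *g starw w >>.

Lemma wsumM Ns Ns' f g : wsum Ns f * wsum Ns' g =
  wsum (Ns ++ Ns') (fun w => f (take (size Ns) w) * g (drop (size Ns) w)).
Proof.
rewrite /wsum words_cat mulr_suml; apply: eq_big_seq => u uN.
rewrite mulr_sumr; apply: eq_bigr => v _.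
by rewrite gaUU starw_cat -(size_words uN) take_size_cat // drop_size_cat.
Qed.

(** Allows factors with different letter ranges to be multiplied over a common range; the
    coefficient remembers the original one. *)
Lemma wsum_widen Ns Ns' f : all2 leq Ns Ns' ->
  wsum Ns f = wsum Ns' (fun w => if w \in words Ns then f w else 0).
Proof.
move=> le; rewrite /wsum (words_widen _ le) big_mkcond; apply: eq_bigr => w _.
by case: ifP => // _; rewrite monalgU0.
Qed.

Lemma gatrace_wsum Ns f :
  gatrace (wsum Ns f) = \sum_(w <- words Ns | starw w == 1%g) f w.
Proof.
rewrite /gatrace raddf_sum /= [RHS]big_mkcond; apply: eq_bigr => w _.
by rewrite mcoeffU; case: eqP; rewrite ?mulr1n ?mulr0n.
Qed.

Lemma gatrace_wsum_le k N m f (C : R[i]) : (0 < N)%N -> 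
  (forall w, `|f w| <= C) ->
  (forall w, w \in words (nseq k N) -> starw w = 1%g -> f w != 0 ->
    (size (undup w) <= m)%N) ->
  `|gatrace (wsum (nseq k N) f)| <= C * (k`! * N ^ m)%:R.
Proof.
move=> N0 fC fm; have C0 : 0 <= C by apply: le_trans (fC [::]).
rewrite gatrace_wsum; apply: le_trans (ler_norm_sum _ _ _) _.
apply: (@le_trans _ _ (\sum_(w <- words (nseq k N) | (size (undup w) <= m)%N) C)).
  rewrite [leLHS]big_mkcond [leRHS]big_mkcond [leLHS]big_seq [leRHS]big_seq /=; apply: ler_sum => w wN.
  case: eqP => [w1|_]; last by case: ifP.
  case: ifP => [_|wm]; first exact: fC.
  have [->|fw] := eqVneq (f w) 0; first by rewrite normr0.
  by rewrite fm in wm.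
rewrite big_const_seq iter_addr addr0 -[leLHS]mulr_natr.
by apply: ler_wpM2l => //; rewrite ler_nat; exact: count_words_le.
Qed.

Lemma rsqrt_exp_le n j : rsqrt n ^+ j.+1 <= rsqrt n.
Proof. by rewrite exprS ler_piMr ?rsqrt_ge0 ?exprn_ile1 ?rsqrt_ge0 ?rsqrt_le1. Qed.

(** The class of test elements: it is closed under products, and the normalization n^(-k/2) is
    exactly what keeps traces bounded. The constants [K] and [C] are uniform in n. *)
Definition word_sum_of k K (C : R[i]) (f : nat -> seq nat -> R[i]) x :=
  [/\ (0 < K)%N, forall n w, `|f n w| <= C
    & forall n, x n = rsqrt n ^+ k *: wsum (nseq k (K * n)) (f n)].

Definition word_sum k x := exists K C (f : nat -> seq nat -> R[i]), word_sum_of k K C f x.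

Lemma word_sum_of_widen k K K' C (f : nat -> seq nat -> R[i]) x :
  (K <= K')%N -> word_sum_of k K C f x ->
  word_sum_of k K' C (fun n w => if w \in words (nseq k (K * n)) then f n w else 0) x.
Proof.
move=> KK [K0 fC xE]; split; first exact: leq_trans KK.
  move=> n w; case: ifP => // _; rewrite normr0.
  by apply: le_trans (fC n w).
move=> n; rewrite xE; congr (_ *: _); apply: wsum_widen.
by elim: k {xE} => //= k ->; rewrite leq_mul2r KK orbT.
Qed.

Lemma word_sum_ofM k l K C D (f g : nat -> seq nat -> R[i]) x y :
  word_sum_of k K C f x -> word_sum_of l K D g y ->
  word_sum_of (k + l) K (C * D)
    (fun n w => f n (take k w) * g n (drop k w)) (fun n => x n * y n).
Proof.
move=> [K0 fC xE] [_ gD yE]; split; [exact: K0|move=> n w|move=> n].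
  by rewrite normrM ler_pM.
by rewrite xE yE -scalerAl -scalerAr scalerA exprD wsumM nseqD size_nseq.
Qed.

Lemma word_sumM k l x y : word_sum k x -> word_sum l y ->
  word_sum (k + l) (fun n => x n * y n).
Proof.
move=> [K [C [f xf]]] [L [D [g yg]]].
have {}xf := word_sum_of_widen (leq_maxl K L) xf.
have {}yg := word_sum_of_widen (leq_maxr K L) yg.
by do 3![eexists]; exact: word_sum_ofM xf yg.
Qed.

Lemma word_sum1 : word_sum 0 (fun=> 1).
Proof.
exists 1%N, 1, (fun _ _ => 1); split=> // [n w|n]; first by rewrite normr1.
by rewrite expr0 scale1r /wsum big_seq1.
Qed.

(** Power counting: of the order of n^m words against the normalization n^(-k/2). *)
Lemma rsqrt_count_le n k K m : (0 < n)%N -> (m.*2 <= k)%N ->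
  rsqrt n ^+ k * (k`! * (K * n) ^ m)%:R = (k`! * K ^ m)%:R * rsqrt n ^+ (k - m.*2).
Proof.
move=> n0 mk; rewrite expnMn mulnA natrM mulrC -mulrA; congr (_ * _).
rewrite -{1}(subnK mk) exprD mulrCA -mul2n exprM natrX -exprMn.
by rewrite rsqrt_sqr // expr1n mulr1.
Qed.

Lemma word_sum_of_trace_le k K C m (f : nat -> seq nat -> R[i]) x :
  word_sum_of k K C f x -> (m.*2 <= k)%N ->
  (forall n w, w \in words (nseq k (K * n)) -> starw w = 1%g -> f n w != 0 ->
    (size (undup w) <= m)%N) ->
  exists2 D, 0 <= D &
    forall n, (0 < n)%N -> `|gatrace (x n)| <= D * rsqrt n ^+ (k - m.*2).
Proof.
move=> [K0 fC xE] mk fm; exists (C * (k`! * K ^ m)%:R) => [|n n0].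
  by rewrite mulr_ge0 ?ler0n //; apply: le_trans (fC 0%N [::]).
rewrite xE linearZ /= normrM ger0_norm ?exprn_ge0 ?rsqrt_ge0 //.
rewrite -mulrA -(rsqrt_count_le K n0 mk) mulrCA ler_wpM2l ?exprn_ge0 ?rsqrt_ge0 //.
by apply: gatrace_wsum_le; [rewrite muln_gt0 K0 | exact: fC | exact: fm].
Qed.

(** Only words with trivial product contribute; they have at most k/2 distinct letters, so their
    number is compensated by the normalization. *)
Lemma word_sum_trace_bounded k x : word_sum k x ->
  exists D, forall n, (0 < n)%N -> `|gatrace (x n)| <= D.
Proof.
move=> [K [C [f xf]]].
have mk : (k./2.*2 <= k)%N by rewrite -[leqRHS]odd_double_half leq_addl.
have [|D D0 xD] := word_sum_of_trace_le xf mk.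
  move=> n w wN w1 _; rewrite geq_half_double -[leqRHS](size_nseq k (K * n)) -(size_words wN).
  exact: starw1_undup (words0 wN) w1.
exists D => n n0; apply: le_trans (xD n n0) _.
by rewrite ler_piMr // exprn_ile1 ?rsqrt_ge0 ?rsqrt_le1.
Qed.

(* Operator norms are not controlled, so errors are measured by the trace of
   their products with arbitrary word sums: this makes them stable under
   multiplication. *)
Definition evanescent x := forall k l y z, word_sum k y -> word_sum l z ->
  exists D, forall n, (0 < n)%N -> `|gatrace (y n * x n * z n)| <= D * rsqrt n.

Lemma evanescent_eq x y : (forall n, (0 < n)%N -> x n = y n) ->
  evanescent x -> evanescent y.
Proof.
move=> xy xN k l u v uk vl; have [D uD] := xN k l u v uk vl.
by exists D => n n0; rewrite -xy //; exact: uD.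
Qed.

Lemma evanescent0 : evanescent (fun=> 0).
Proof.
move=> k l y z _ _; exists 0 => n _.
by rewrite mulr0 mul0r linear0 normr0 mul0r.
Qed.

Lemma evanescentD x y : evanescent x -> evanescent y -> evanescent (fun n => x n + y n).
Proof.
move=> xN yN k l u v uk vl; have [D uD] := xN k l u v uk vl.
have [E uE] := yN k l u v uk vl; exists (D + E) => n n0.
rewrite mulrDr mulrDl linearD /= mulrDl; apply: le_trans (ler_normD _ _) _.
exact: lerD (uD n n0) (uE n n0).
Qed.

Lemma evanescentZ (c : R[i]) x : evanescent x -> evanescent (fun n => c *: x n).
Proof.
move=> xN k l u v uk vl; have [D uD] := xN k l u v uk vl.
exists (`|c| * D) => n n0.
rewrite -scalerAr -scalerAl linearZ /= normrM -[leRHS]mulrA.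
exact: ler_wpM2l (normr_ge0 c) _ _ (uD n n0).
Qed.

Lemma evanescentMl k x y : word_sum k y -> evanescent x -> evanescent (fun n => y n * x n).
Proof.
move=> yk xN a b u v ua vb; have [D uD] := xN _ _ _ _ (word_sumM ua yk) vb.
by exists D => n n0; rewrite mulrA; exact: uD.
Qed.

Lemma evanescentMr k x y : word_sum k y -> evanescent x -> evanescent (fun n => x n * y n).
Proof.
move=> yk xN a b u v ua vb; have [D uD] := xN _ _ _ _ ua (word_sumM yk vb).
exists D => n n0; rewrite (mulrA (u n)) -(mulrA (u n * x n)); exact: uD.
Qed.

Lemma evanescent_trace x : evanescent x ->
  exists D, forall n, (0 < n)%N -> `|gatrace (x n)| <= D * rsqrt n.
Proof.
move=> /(_ _ _ _ _ word_sum1 word_sum1)[D xD].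
by exists D => n /xD; rewrite mul1r mulr1.
Qed.

(** A vanishing scalar is enough, as traces of word sums stay bounded. *)
Lemma evanescent_small k x (c : nat -> R[i]) : word_sum k x ->
  (exists D, forall n, (0 < n)%N -> `|c n| <= D * rsqrt n) ->
  evanescent (fun n => c n *: x n).
Proof.
move=> xk [E cE] a b u v ua vb.
have [D uD] := word_sum_trace_bounded (word_sumM (word_sumM ua xk) vb).
exists (E * D) => n n0.
rewrite -scalerAr -scalerAl linearZ /= normrM mulrAC.
exact: ler_pM (normr_ge0 _) (normr_ge0 _) (cE n n0) (uD n n0).
Qed.

(** [bad_word_undup] holds in any context u, v, so multiplying by test elements on both sides keeps
    the deficit in distinct letters, which leaves a factor [rsqrt n]. *)
Lemma evanescent_bad k K C (f : nat -> seq nat -> R[i]) x : word_sum_of k K C f x ->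
  (forall n w, f n w != 0 -> bad_word w) -> evanescent x.
Proof.
(* The empty word is not bad, so in length 0 the sum vanishes. *)
case: k => [|k] xf fb.
  apply: evanescent_eq evanescent0 => n _; have [_ _ ->] := xf.
  rewrite /wsum big_seq1; have [->|/fb] := eqVneq (f n [::]) 0.
    by rewrite monalgU0 scaler0.
  by case=> p [? [? [? [? [+ _ _]]]]]; case: p.
move=> a b u v [Ku [Cu [fu uf]]] [Kv [Cv [fv vf]]].
have [K' [KK KuK KvK]] : exists K', [/\ K <= K', Ku <= K' & Kv <= K']%N.
  by exists (K + Ku + Kv)%N; split; lia.
have {}xf := word_sum_of_widen KK xf; have {}uf := word_sum_of_widen KuK uf.
have {}vf := word_sum_of_widen KvK vf.
have uxv := word_sum_ofM (word_sum_ofM uf xf) vf.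
(* The total length is [a + k + b + 1]; the strict bound on distinct letters gives at most [m] of
   them, and the exponent of [rsqrt n] that remains is at least 1. *)
pose m := (a + k + b)./2.
have mk : (m.*2 <= a + k + b)%N by rewrite -[leqRHS]odd_double_half leq_addl.
have [||D D0 uD] := @word_sum_of_trace_le _ _ _ m _ _ uxv.
- by rewrite addnS addSn leqW.
- move=> n w wN w1; rewrite !mulf_eq0 !negb_or => /andP[/andP[_ fw] _].
  rewrite geq_half_double -ltnS.
  have sw : size w = (a + k + b).+1 by rewrite (size_words wN) size_nseq addnS addSn.
  set w' := drop a (take (a + k.+1) w) in fw.
  have wE : w = take a w ++ w' ++ drop (a + k.+1) w.
    rewrite -{1}(cat_take_drop (a + k.+1) w) catA; congr (_ ++ _).
    by rewrite -{1}(cat_take_drop a (take (a + k.+1) w)) take_takel // leq_addr.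
  have bw : bad_word w' by apply: (fb n); apply: contraNneq fw => ->; case: ifP.
  have := words0 wN; move: w1; rewrite -sw {1}wE => w1 w0; rewrite wE.
  by apply: bad_word_undup => //; rewrite -wE.
exists D => n n0; apply: le_trans (uD n n0) _.
rewrite ler_wpM2l // addnS addSn subSn //; exact: rsqrt_exp_le.
Qed.

End WordSums.

(** * Sums of cycles and multiplication by a letter *)

Section CycleSums.
Context (R : realType).
Local Notation KG := (groupAlg R[i] finPerm).
Implicit Types (n k : nat) (s t : R) (w : seq R).

Definition nletters n t : nat := Num.truncn (n%:R * t).

Lemma nletters_min n s t : minn (nletters n s) (nletters n t) = nletters n (Num.min s t).
Proof.
rewrite /nletters; have [st|st] := leP s t; [apply/minn_idPl|apply/minn_idPr].
  by rewrite le_truncn // ler_wpM2l.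
by rewrite le_truncn // ler_wpM2l // ltW.
Qed.

Lemma nletters_widen w : exists2 K, (0 < K)%N &
  forall n, all2 leq (map (nletters n) w) (nseq (size w) (K * n)).
Proof.
elim: w => [|t w [K K0 wK]]; first by exists 1%N.
exists (maxn K (Num.truncn t).+1) => [|n]; first by rewrite leq_max K0.
have KK : (K <= maxn K (Num.truncn t).+1)%N by exact: leq_maxl.
rewrite /=; apply/andP; split.
  apply: (@leq_trans (n * (Num.truncn t).+1)); last first.
    by rewrite mulnC leq_mul2r leq_maxr orbT.
  rewrite -(@natrK R (n * _)) natrM le_truncn // ler_wpM2l //.
  by rewrite ltW // truncnS_gt.
elim: (w) (wK n) => //= x w' IH /andP[xK /IH ->]; rewrite andbT.
by apply: leq_trans xK _; rewrite leq_mul2r KK orbT.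
Qed.

Definition letter_wsum w (f : nat -> seq nat -> R[i]) n : KG :=
  rsqrt R n ^+ size w *: wsum (map (nletters n) w) (f n).

Lemma letter_wsum_word_sum w (f : nat -> seq nat -> R[i]) C :
  (forall n a, size a = size w -> `|f n a| <= C) ->
  exists K, word_sum_of (size w) K C
    (fun n a => if a \in words (map (nletters n) w) then f n a else 0) (letter_wsum w f).
Proof.
move=> fC; have [K K0 wK] := nletters_widen w.
exists K; split=> [//|n a|n].
  case: ifP => [/size_words aw|_]; first by rewrite fC // aw size_map.
  by rewrite normr0; apply: le_trans (fC 0%N (nseq (size w) 0%N) _); rewrite ?size_nseq.
by rewrite /letter_wsum (wsum_widen _ (wK n)).
Qed.

(** Finite-n counterpart of the tensor with factors [w]: by [finperm_cycle_starw] the words without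
    repetition give cycles, and a constant [w] gives M_r(n,t) ([Mcycles_cycle_sum]). *)
Definition cycle_sum n w : KG := letter_wsum w (fun _ a => (uniq a)%:R) n.

Lemma bool_norm_le1 (b : bool) : `|b%:R : R[i]| <= 1.
Proof. by case: b; rewrite ?normr1 ?normr0. Qed.

Lemma cycle_sum_word_sum w : word_sum (size w) (cycle_sum ^~ w).
Proof.
have [|K wK] := @letter_wsum_word_sum w (fun _ a => (uniq a)%:R) 1.
  by move=> n a _; exact: bool_norm_le1.
by do 3!eexists; exact: wK.
Qed.

(* Index set R instead of [0, +oo[: letters of negative index are null. *)
Definition tmin s t : R := Num.max 0 (Num.min s t).

(** The rounding error of floor(n t) / n is at most 1 / n. A negative t gives no letter at all,
    hence the maximum with 0. *)
Lemma nletters_cvg t n : (0 < n)%N ->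
  `|(nletters n t)%:R * rsqrt R n ^+ 2 - (Num.max 0 t)%:C| <= 1 * rsqrt R n.
Proof.
move=> n0; rewrite mul1r; apply: le_trans (rsqrt_exp_le R n 1).
have s0 : 0 <= rsqrt R n ^+ 2 by rewrite exprn_ge0 ?rsqrt_ge0.
have -> : (Num.max 0 t)%:C = (n%:R * Num.max 0 t)%:C * rsqrt R n ^+ 2.
  by rewrite rmorphM rmorph_nat mulrAC rsqrt_sqr // mul1r.
rewrite -mulrBl normrM (ger0_norm s0) ler_piMl //.
rewrite -(rmorph_nat (real_complex R)) -rmorphB /= normc_def /= expr0n addr0 sqrtr_sqr.
rewrite -[leRHS]/(1%:C) lecR /nletters.
have [t0|t0] := leP 0 t.
  have /truncn_itv/andP[le1 lt1] : 0 <= n%:R * t by rewrite mulr_ge0.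
  rewrite distrC ger0_norm ?subr_ge0 // lerBlDl -natr1 in lt1 *.
  by rewrite ltW // -natr1.
have -> : Num.truncn (n%:R * t) = 0%N.
  apply/truncn0Pn; rewrite -ltNge (le_lt_trans _ ltr01) // mulr_ge0_le0 // ltW //.
by rewrite mulr0 subr0 normr0.
Qed.

Lemma wsum_cons N Ns (f : seq nat -> R[i]) : wsum (N :: Ns) f =
  \sum_(a <- iota 1 N) \sum_(v <- words Ns) << f (a :: v) *g starw (a :: v) >> :> KG.
Proof. by rewrite /wsum /= big_allpairs_dep. Qed.

Lemma wsumD Ns (f g : seq nat -> R[i]) :
  wsum Ns (fun a => f a + g a) = wsum Ns f + wsum Ns g.
Proof. by rewrite /wsum -big_split /=; apply: eq_bigr => a _; rewrite monalgUD. Qed.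

Lemma wsum_eq Ns (f g : seq nat -> R[i]) : {in words Ns, f =1 g} -> wsum Ns f = wsum Ns g.
Proof. by move=> fg; apply: eq_big_seq => a aN; rewrite fg. Qed.

Lemma wsumZ Ns c (f : seq nat -> R[i]) : wsum Ns (fun a => c * f a) = c *: wsum Ns f.
Proof. by rewrite /wsum scaler_sumr; apply: eq_bigr => a _; rewrite gaZU. Qed.

(** These are the letters ruled out for a cancelling pair in front of [c], because they already
    occur in [c]. *)
Definition hits n s t (c : seq nat) : nat :=
  count (fun a => (a <= nletters n t)%N && (a \in c)) (iota 1 (nletters n s)).

Lemma count_le_iota M N : count (leq^~ M) (iota 1 N) = minn N M.
Proof.
elim: N => [|N IH]; first by rewrite min0n.
rewrite -{1}[N.+1]addn1 iotaD count_cat IH /= addn0 add1n; case: (leqP N.+1 M); lia.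
Qed.

Lemma hits_le n s t c : (hits n s t c <= size c)%N.
Proof.
rewrite /hits -size_filter; apply: uniq_leq_size; first exact: filter_uniq (iota_uniq _ _).
by move=> a; rewrite mem_filter => /andP[/andP[]].
Qed.

Lemma count_natr (T : Type) (P : pred T) (r : seq T) :
  (count P r)%:R = \sum_(a <- r) (P a)%:R :> R[i].
Proof.
by rewrite -sum1_count natr_sum big_mkcond; apply: eq_bigr => a _; case: (P a).
Qed.

(** Two equal transpositions cancel and leave [c]. Their common letter ranges up to the smaller of
    the two bounds, the letters of [c] excepted. *)
Lemma wsum_contract n s t w :
  wsum [:: nletters n s, nletters n t & map (nletters n) w]
    (fun v => ((nth 0 v 0 == nth 0 v 1)%N && uniq (behead v))%:R) =
  (nletters n (Num.min s t))%:R *: wsum (map (nletters n) w) (fun c => (uniq c)%:R) -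
  wsum (map (nletters n) w) (fun c => (uniq c)%:R * (hits n s t c)%:R) :> KG.
Proof.
rewrite -nletters_min -wsumZ -[X in _ - X]scale1r -scaleNr -wsumZ -wsumD.
rewrite wsum_cons; under eq_bigr do rewrite big_allpairs_dep exchange_big /=.
rewrite exchange_big; apply: eq_bigr => c _ /=.
set M := nletters n t; set N := nletters n s.
transitivity (\sum_(a <- iota 1 N)
  << ((a <= M)%N && uniq (a :: c))%:R *g starw c >> : KG).
  apply: eq_big_seq => a; rewrite mem_iota add1n ltnS => /andP[a0 aN].
  have a0' : a != 0%N by rewrite -lt0n.
  have F b : << ((a == b) && uniq (b :: c))%:R *g starw [:: a, b & c] >> =
      if b == a then << (uniq (a :: c))%:R *g starw c >> else 0 :> KG.
    rewrite [b == a]eq_sym; case: eqVneq => [<-|_]; last by rewrite monalgU0.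
    by rewrite [starw _]mulgA (star_transpK a0') mul1g.
  under eq_bigr do rewrite F.
  rewrite -big_mkcond /=; have [aM|aM] := leqP a M.
    have am : a \in iota 1 M by rewrite mem_iota add1n ltnS a0.
    by rewrite -big_filter filter_pred1_uniq ?iota_uniq // big_seq1.
  rewrite monalgU0 big_seq_cond big_pred0 // => b.
  by apply/negP => /andP[+ /eqP ba]; rewrite ba mem_iota add1n ltnS [(a <= M)%N]leqNgt aM andbF.
rewrite -raddf_sum; congr (<< _ *g _ >>).
rewrite mulN1r mulrC -mulrBr -count_le_iota !count_natr -sumrB mulr_sumr.
apply: eq_bigr => a _ /=; case: (uniq c); rewrite ?andbF ?mul0r // mul1r andbT.
by case: (a <= M)%N; case: (a \in c); rewrite /= ?subrr ?subr0.
Qed.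

Lemma cycle_sum_mul n t s w : cycle_sum n [:: t] * cycle_sum n (s :: w) =
  rsqrt R n ^+ (size w).+2 *: wsum [:: nletters n t, nletters n s & map (nletters n) w]
    (fun v => (uniq (behead v))%:R).
Proof.
rewrite /cycle_sum /letter_wsum -scalerAl -scalerAr scalerA -exprD wsumM /=.
congr (_ *: _); apply: wsum_eq => v /size_words /=; case: v => //= a v _.
by rewrite take0 drop0 mul1r.
Qed.

(** The three terms become creation ([a] is new), annihilation ([a] cancels against [b]) and bad
    words ([a] comes back later). *)
Lemma uniq_cons_split (a b : nat) (c : seq nat) :
  (uniq (b :: c))%:R = (uniq [:: a, b & c])%:R + ((a == b) && uniq (b :: c))%:R +
    ((a \in c) && uniq (b :: c))%:R :> R[i].
Proof.
have -> : uniq [:: a, b & c] = [&& a != b, a \notin c & uniq (b :: c)].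
  by rewrite cons_uniq in_cons negb_or -andbA.
have [/= /andP[bc _]|_] := boolP (uniq (b :: c)); last by rewrite !andbF !addr0.
rewrite !andbT; have [->|_] /= := eqVneq a b.
  by rewrite (negPf bc) add0r addr0.
by case: (a \in c); rewrite ?addr0 ?add0r.
Qed.

(** By [uniq_cons_split], new letters give the longer cycle sum, letters coming back later give bad
    words, and cancelling pairs give floor(n min(t,s)) / n times the shorter sum, up to the [hits]
    correction. *)
Lemma letter_mul_cycle_sum t s w : evanescent (fun n =>
  cycle_sum n [:: t] * cycle_sum n (s :: w) - cycle_sum n [:: t, s & w] - (tmin t s)%:C *: cycle_sum n w).
Proof.
pose fb (_ : nat) (a : seq nat) : R[i] :=
  ((nth 0%N a 0 \in drop 2 a) && uniq (behead a))%:R.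
pose fh n (c : seq nat) : R[i] := (uniq c)%:R * (hits n t s c)%:R.
have [|K bK] := @letter_wsum_word_sum [:: t, s & w] fb 1.
  by move=> n a _; exact: bool_norm_le1.
have bN : evanescent (letter_wsum [:: t, s & w] fb).
  apply: evanescent_bad bK _ => n a; case: ifP => [/size_words|_]; last by rewrite eqxx.
  rewrite /fb; case: a => [|a [|b c]] //= _; rewrite drop0.
  case: andP => [[ac /andP[bc uc]] _|]; last by rewrite eqxx.
  exists [::], a.
  case/splitPr: ac bc uc => c1 c2; rewrite mem_cat in_cons !negb_or cat_uniq.
  case/and3P => bc1 ba bc2 /and3P[uc1 /norP[ac1 _] _].
  (* The word reads a b c1 a c2. The letter before the second a is the last one of [c1], or [b] if
     [c1] is empty; it occurs once between the two a's since [b :: c] has no repetition. *)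
  case/lastP: c1 bc1 uc1 ac1 => [|c1 y] bc1 uc1 ac1.
    by exists [::], b, c2; split.
  exists (b :: c1), y, c2; split; first by [].
    rewrite rcons_uniq in uc1; case/andP: uc1 => yc1 _.
    rewrite in_cons negb_or yc1 andbT.
    by move: bc1; rewrite mem_rcons in_cons negb_or eq_sym => /andP[].
  by move: ac1; rewrite mem_rcons in_cons negb_or eq_sym => /andP[].
have [|K' hK] := @letter_wsum_word_sum w fh (size w)%:R.
  move=> n c cw; rewrite /fh normrM -[leRHS]mul1r ler_pM ?bool_norm_le1 //.
  by rewrite normr_nat ler_nat -cw hits_le.
(* The cancelled pair leaves the factor 1 / n, while the number of hits is at most [size w]. *)
have hN : evanescent (fun n => rsqrt R n ^+ 2 *: letter_wsum w fh n).
  apply: (@evanescent_small _ (size w)); first by do 3!eexists; exact: hK.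
  exists 1 => n n0; rewrite mul1r ger0_norm ?exprn_ge0 ?rsqrt_ge0 //; exact: rsqrt_exp_le.
have dN : evanescent (fun n =>
    ((nletters n (Num.min t s))%:R * rsqrt R n ^+ 2 - (tmin t s)%:C) *: cycle_sum n w).
  apply: (@evanescent_small _ (size w)); first exact: cycle_sum_word_sum.
  by exists 1 => n n0; exact: nletters_cvg.
apply: evanescent_eq (evanescentD bN (evanescentD dN (evanescentZ (-1) hN))) => n _.
rewrite cycle_sum_mul (@wsum_eq _ _ (fun v => ((uniq v)%:R +
    ((nth 0%N v 0 == nth 0%N v 1) && uniq (behead v))%:R) + fb n v)); last first.
  move=> v /size_words; case: v => [|a [|b c]] //= _; rewrite /fb /= drop0.
  exact: (uniq_cons_split a b c).
rewrite !wsumD wsum_contract.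
rewrite /cycle_sum /letter_wsum scaleN1r !scalerDr scalerN !scalerA.
rewrite -exprD add2n mulrBl -mulrA -exprD add2n scalerBl /= -/(fh n).
rewrite [(nletters _ _)%:R * _]mulrC.
have E (WB W2 W3 W1 W0 : KG) :
    WB + (W1 - W0 - W2) = W3 + (W1 - W2) + WB - W3 - W0.
  rewrite -[W3 + _ + _]addrA [W3 + _]addrC addrK.
  by rewrite [W1 - W0 - W2]addrAC addrA [WB + _]addrC.
exact: E.
Qed.

End CycleSums.

(** * Free algebra and Wick ordering *)

(* The free *-algebra, accessed only through its universal property, so that
   the unifier never unfolds the convolution product of monoid algebras. *)
Record freeStarAlg (R : realType) (I : choiceType) := FreeStarAlg {
  fsa :> algType R[i];
  fword : seq I -> fsa;
  fext : forall V : lmodType R[i], (seq I -> V) -> {linear fsa -> V};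
  fstar : fsa -> fsa;
  fword0 : fword [::] = 1;
  fword_cat : forall u v, fword (u ++ v) = fword u * fword v;
  fext_word : forall (V : lmodType R[i]) (f : seq I -> V) w, fext f (fword w) = f w;
  fsa_ind : forall P : fsa -> Prop, P 0 ->
    (forall c w x, P x -> P (c *: fword w + x)) -> forall x, P x;
  fstar0 : fstar 0 = 0;
  fstarP : forall c w x,
    fstar (c *: fword w + x) = c^* *: fword (rev w) + fstar x }.

Arguments fword {R I} _ _.
Arguments fext {R I} _ {V} _.
Arguments fstar {R I _} _.

Definition freeAlg (K : comNzRingType) (I : choiceType) := {malg K[{fmonom I}]}.

Section FreeAlg.
Context (K : comNzRingType) (I : choiceType).
Local Notation FA := (freeAlg K I).
Implicit Types (x y : FA) (u v w : seq I).

HB.instance Definition _ := GRing.Lalgebra.copy FA {malg K[{fmonom I}]}.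

Definition faword w : FA := << FMonom w >>.

Lemma faword0 : faword [::] = 1.
Proof. by rewrite /faword -fmoneE. Qed.

Lemma freeAlg_sum x : x = \sum_(m <- msupp x) x@_m *: faword m.
Proof.
rewrite {1}[x]monalgE; apply: eq_bigr => m _; rewrite /faword fmK.
by apply/malgP => k; rewrite [RHS]mcoeffZ !mcoeffU mulrnAr mulr1.
Qed.

Lemma freeAlg_ind (P : FA -> Prop) : P 0 ->
  (forall c w x, P x -> P (c *: faword w + x)) -> forall x, P x.
Proof.
move=> P0 PD x; rewrite [x]freeAlg_sum.
by elim: (enum_fset _) => [|m s IH]; rewrite ?big_nil ?big_cons //; exact: PD.
Qed.

Lemma fawordZ (a : K) w : a *: faword w = << a *g FMonom w >>.
Proof. by apply/malgP => k; rewrite [LHS]mcoeffZ !mcoeffU mulrnAr mulr1. Qed.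

Lemma faword_mul (a b : K) u v : (a *: faword u) * (b *: faword v) = (a * b) *: faword (u ++ v).
Proof.
rewrite !fawordZ; transitivity (fgmul (<< a *g FMonom u >> : {malg K[{fmonom I}]}) << b *g FMonom v >>).
  by [].
by rewrite fgmulUU; congr << _ *g _ >>; apply/eqP; rewrite fmP fmM.
Qed.

Lemma faword_cat u v : faword (u ++ v) = faword u * faword v.
Proof. by have := faword_mul 1 1 u v; rewrite mul1r !scale1r. Qed.

Fact freeAlg_scaleAr (a : K) x y : a *: (x * y) = x * (a *: y).
Proof.
elim/freeAlg_ind: x => [|c w x IH]; first by rewrite !mul0r scaler0.
rewrite (mulrDl _ x) (mulrDl _ x) scalerDr.
apply: (f_equal2 +%R); last exact: IH.
elim/freeAlg_ind: y {IH} => [|d v y IH]; first by rewrite !(mulr0, scaler0).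
rewrite (mulrDr _ _ y) (scalerDr a _ y) (mulrDr _ _ (a *: y)) scalerDr.
apply: (f_equal2 +%R); last exact: IH.
transitivity ((a * (c * d)) *: faword (w ++ v)).
  by rewrite (faword_mul c d w v) scalerA.
by rewrite scalerA (faword_mul c (a * d) w v) mulrCA.
Qed.

HB.instance Definition _ := GRing.Lalgebra_isAlgebra.Build K FA freeAlg_scaleAr.

Section LinearExtension.
Context (V : lmodType K) (F : seq I -> V).

Definition faext x : V := \sum_(m <- msupp x) x@_m *: F m.

Lemma faextEw (d : {fset {fmonom I}}) x : (msupp x `<=` d)%fset ->
  faext x = \sum_(m <- d) x@_m *: F m.
Proof.
move=> xd; apply: big_fset_incl => // m _ /mcoeff_outdom ->.
by rewrite scale0r.
Qed.

Fact faext_linear : linear faext.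
Proof.
move=> a x y; pose d := (msupp x `|` msupp y)%fset.
have ad : (msupp (a *: x + y) `<=` d)%fset.
  apply: fsubset_trans (msuppD_le _ _) _.
  by apply: fsetSU; exact: msuppZ_le.
rewrite (faextEw ad) (faextEw (fsubsetUl _ _ : msupp x `<=` d)%fset).
rewrite (faextEw (fsubsetUr _ _ : msupp y `<=` d)%fset) scaler_sumr -big_split /=.
by apply: eq_bigr => m _; rewrite mcoeffD mcoeffZ scalerDl scalerA.
Qed.

HB.instance Definition _ := GRing.isLinear.Build K FA V *:%R faext faext_linear.

Lemma faext_word w : faext (faword w) = F w.
Proof.
by rewrite (faextEw (msuppU_le : msupp (faword w) `<=` [fset FMonom w])%fset)
  big_seq_fset1 mcoeffUU scale1r.
Qed.

End LinearExtension.

End FreeAlg.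

Section FreeStar.
Context (R : realType) (I : choiceType).
Local Notation FA := (freeAlg R[i] I).

Definition fastar (x : FA) : FA :=
  \sum_(m <- msupp x) << (x@_m)^* *g FMonom (rev m) >>.

Lemma fastarE (x : FA) (m : {fmonom I}) : (fastar x)@_m = (x@_(FMonom (rev m)))^*.
Proof.
have revE (k : {fmonom I}) : (FMonom (rev k) == m) = (k == FMonom (rev m)).
  by rewrite !fmP /=; apply/eqP/eqP => [<-|->]; rewrite revK.
rewrite /fastar raddf_sum /=; under eq_bigr do rewrite mcoeffU revE.
have [gx|gx] := msuppP x (FMonom (rev m)).
  rewrite (big_fsetD1 _ gx) /= eqxx mulr1n big1_fset ?addr0 // => k.
  by rewrite in_fsetD1 => /andP[/negPf-> _] _.
rewrite rmorph0 big1_fset // => k kx _; case: eqP => // km.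
by move: gx; rewrite -km kx.
Qed.

Fact fastarP c w (x : FA) :
  fastar (c *: faword R[i] w + x) = c^* *: faword R[i] (rev w) + fastar x.
Proof.
apply/malgP => m; rewrite fastarE mcoeffD mcoeffZ [in RHS]mcoeffD [in RHS]mcoeffZ fastarE.
rewrite rmorphD rmorphM; congr (_ * _ + _).
by rewrite !mcoeffU rmorph_nat !fmP /= (can2_eq revK revK).
Qed.

Fact fastar0 : fastar 0 = 0.
Proof. by rewrite /fastar msupp0 big_seq_fset0. Qed.

Lemma freeStarAlg_exists : freeStarAlg R I.
Proof.
exact: (@FreeStarAlg R I (freeAlg R[i] I) (@faword R[i] I)
  (fun V f => @faext R[i] I V f) fastar (@faword0 _ _) (@faword_cat _ _)
  (@faext_word _ _) (@freeAlg_ind _ _) fastar0 fastarP).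
Qed.

End FreeStar.

(** * Fock space operators and the vacuum state for a covariance [B] *)

Section Wick.
Context (R : realType) (I : choiceType) (FA : freeStarAlg R I) (B : I -> I -> R[i]).
Local Notation K := R[i].
Implicit Types (x y : FA) (u v w : seq I) (s t : I) (L : seq (K * I)).

Definition vacuum : FA -> K := fext FA (fun w => (w == [::])%:R : K^o).

Fact vacuum_linear : scalar vacuum.
Proof. by move=> a x y; rewrite /vacuum linearP. Qed.

HB.instance Definition _ := GRing.isLinear.Build K FA K *%R vacuum vacuum_linear.

Lemma vacuum_word w : vacuum (fword FA w) = (w == [::])%:R.
Proof. exact: fext_word. Qed.

Lemma vacuum_cons t x : vacuum (fword FA [:: t] * x) = 0.
Proof.
elim/fsa_ind: x => [|c w x IH]; first by rewrite mulr0 linear0.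
by rewrite mulrDr linearD /= IH addr0 -scalerAr linearZ /= -fword_cat vacuum_word mulr0.
Qed.

(** Left annihilation operator of the full Fock space: words stand for elementary tensors, and the
    vacuum vector 1 is sent to 0. *)
Definition annih t : FA -> FA :=
  fext FA (fun w => if w is s :: w' then B t s *: fword FA w' else 0).

HB.instance Definition _ t := GRing.Linear.on (annih t).

Lemma annih1 t : annih t 1 = 0.
Proof. by rewrite -fword0 [LHS]fext_word. Qed.

Lemma annih_word t s w : annih t (fword FA (s :: w)) = B t s *: fword FA w.
Proof. exact: fext_word. Qed.

Lemma annih_cons t s x : annih t (fword FA [:: s] * x) = B t s *: x.
Proof.
elim/fsa_ind: x => [|c w x IH]; first by rewrite mulr0 linear0 scaler0.
rewrite mulrDr linearD /= IH scalerDr; congr (_ + _).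
rewrite -scalerAr linearZ /= -fword_cat [X in _ *: X]fext_word /=.
by rewrite !scalerA mulrC.
Qed.

(** A word is sent to the Fock vector that the product of its creation plus annihilation operators
    produces from the vacuum vector 1; the free algebra serves both as algebra and as Fock space. *)
Definition wick : FA -> FA :=
  fext FA (foldr (fun t y => fword FA [:: t] * y + annih t y) 1).

HB.instance Definition _ := GRing.Linear.on wick.

Lemma wick1 : wick 1 = 1.
Proof. by rewrite -[X in wick X]fword0 [LHS]fext_word. Qed.

Lemma wick_cons t x :
  wick (fword FA [:: t] * x) = fword FA [:: t] * wick x + annih t (wick x).
Proof.
elim/fsa_ind: x => [|c w x IH]; first by rewrite !(mulr0, linear0) addr0.
rewrite mulrDr !linearD /= IH mulrDr addrACA; congr (_ + _).
rewrite -scalerAr !linearZ /= -scalerAr -scalerDr -fword_cat; congr (_ *: _).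
by rewrite ![wick _]fext_word.
Qed.

Definition wick_state x : K := vacuum (wick x).

Fact wick_state_linear : scalar wick_state.
Proof. by move=> a x y; rewrite /wick_state !linearP. Qed.

HB.instance Definition _ := GRing.isLinear.Build K FA K *%R wick_state wick_state_linear.

Definition fock_field L : FA := \sum_(p <- L) p.1 *: fword FA [:: p.2].

Definition annihs L x : FA := \sum_(p <- L) p.1 *: annih p.2 x.

Fact annihs_linear L : linear (annihs L).
Proof.
move=> a x y; rewrite /annihs scaler_sumr -big_split; apply: eq_bigr => p _ /=.
by rewrite linearP scalerDr !scalerA mulrC.
Qed.

HB.instance Definition _ L := GRing.isLinear.Build K FA FA *:%R (annihs L) (annihs_linear L).

Definition fcov L L' : K := \sum_(p <- L) \sum_(q <- L') p.1 * q.1 * B p.2 q.2.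

Lemma wick_field L x : wick (fock_field L * x) = fock_field L * wick x + annihs L (wick x).
Proof.
rewrite /fock_field !mulr_suml linear_sum -big_split; apply: eq_bigr => p _ /=.
by rewrite -scalerAl linearZ /= wick_cons scalerDr scalerAl.
Qed.

Lemma annihs1 L : annihs L 1 = 0.
Proof. by rewrite /annihs big1 // => p _; rewrite annih1 scaler0. Qed.

Lemma annihs_field L L' x : annihs L (fock_field L' * x) = fcov L L' *: x.
Proof.
rewrite /annihs /fcov scaler_suml; apply: eq_bigr => p _.
rewrite /fock_field mulr_suml linear_sum scaler_sumr scaler_suml; apply: eq_bigr => q _.
by rewrite -scalerAl linearZ /= annih_cons !scalerA.
Qed.

Lemma vacuum_field L x : vacuum (fock_field L * x) = 0.
Proof.
rewrite /fock_field mulr_suml linear_sum big1 // => p _.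
by rewrite -scalerAl linearZ /= vacuum_cons mulr0.
Qed.

(* Wick ordering replaces the polynomial p by a polynomial q with constant
   coefficient the expectation of p. *)
Lemma wick_poly L (p : {poly K}) : exists q : {poly K},
  forall x, annihs L (wick x) = 0 ->
    wick (horner_alg (fock_field L) p * x) = horner_alg (fock_field L) q * wick x.
Proof.
elim/poly_ind: p => [|p c [q pq]].
  by exists 0 => x _; rewrite !rmorph0 !mul0r linear0.
have [q' [c' qE]] : exists q' c', q = q' * 'X + c'%:P.
  by elim/poly_ind: (q) => [|q' c' _]; [exists 0, 0; rewrite mul0r addr0 | exists q', c'].
(* Creation gives ['X * q]; annihilation removes one field from each nonconstant term of [q], giving
   [fcov L L *: q']. The constant term of [q] contributes nothing to it, since [annihs L] kills
   [wick x]. *)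
exists ('X * q + fcov L L *: q' + c%:P) => x x0.
have XE r : horner_alg (fock_field L) ('X * r) = fock_field L * horner_alg (fock_field L) r.
  by rewrite rmorphM /= horner_algX.
rewrite commr_polyX !rmorphD /= XE !horner_algC !mulrDl linearD /= -mulrA wick_field pq //.
rewrite XE linearZ /= -scalerAl -!scalerAl !mul1r linearZ /= -!addrA mulrA; congr (_ + (_ + _)).
rewrite qE commr_polyX rmorphD /= XE horner_algC mulrDl linearD /= -mulrA annihs_field.
by rewrite -!scalerAl mul1r linearZ /= x0 scaler0 addr0.
Qed.

(** The Wick-ordered polynomial has the expectation of [p] as constant coefficient; for centered [p]
    a field therefore factors out on the left. *)
Lemma wick_state_field_poly L (p : {poly K}) (x : FA) :
  wick_state (horner_alg (fock_field L) p) = 0 -> annihs L (wick x) = 0 ->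
  exists y, wick (horner_alg (fock_field L) p * x) = fock_field L * y.
Proof.
have [q pq] := wick_poly L p; move=> p0 x0.
have [q' [c' qE]] : exists q' c', q = 'X * q' + c'%:P.
  elim/poly_ind: (q) => [|q' c' _]; first by exists 0, 0; rewrite mulr0 addr0.
  by exists q', c'; rewrite commr_polyX.
have XE r : horner_alg (fock_field L) ('X * r) = fock_field L * horner_alg (fock_field L) r.
  by rewrite rmorphM /= horner_algX.
have qF y : horner_alg (fock_field L) q * y = fock_field L * (horner_alg (fock_field L) q' * y) + c' *: y.
  by rewrite qE rmorphD /= XE horner_algC mulrDl mulrA -scalerAl mul1r.
(* With x = 1 the vacuum kills everything that starts with a field, so [c'] is the expectation of
   [p]. *)
have c0 : c' = 0.
  have := pq 1; rewrite mulr1 wick1 annihs1 => /(_ erefl) => w1.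
  move: p0; rewrite /wick_state w1 qF linearD /= vacuum_field add0r linearZ /=.
  by rewrite -fword0 vacuum_word mulr1.
by exists (horner_alg (fock_field L) q' * wick x); rewrite pq // qF c0 scale0r addr0.
Qed.

End Wick.

(** * Convergence of moments *)

Section ScaledChebyshev.
Context (K : comNzRingType).

Lemma coef_scaled_chebyshevU r (t : K) k :
  (scaled_chebyshevU r t)`_k = (chebyshevU K r)`_k * t ^+ (r - k)./2.
Proof.
rewrite coef_poly ltnS; case: leqP => // rk.
by rewrite chebyshevU_coef0 ?rk // mul0r.
Qed.

Lemma scaled_chebyshevU0 (t : K) : scaled_chebyshevU 0 t = 1.
Proof.
apply/polyP => k; rewrite coef_scaled_chebyshevU /= coef1.
by case: k => [|k]; rewrite ?mulr1 ?mul0r.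
Qed.

Lemma scaled_chebyshevU1 (t : K) : scaled_chebyshevU 1 t = 'X.
Proof.
apply/polyP => k; rewrite coef_scaled_chebyshevU /= coefX.
by case: k => [|[|k]]; rewrite ?mulr1 ?mul0r.
Qed.

(** For k <= r the exponent (r + 2 - k)./2 exceeds (r - k)./2 by one, which is the factor t; for k >
    r the coefficient of U_r vanishes. *)
Lemma scaled_chebyshevUSS r (t : K) : scaled_chebyshevU r.+2 t =
  'X * scaled_chebyshevU r.+1 t - t *: scaled_chebyshevU r t.
Proof.
apply/polyP => k; rewrite coefB coefZ coefXM !coef_scaled_chebyshevU.
rewrite [chebyshevU K r.+2]/('X * chebyshevU K r.+1 - chebyshevU K r).
rewrite coefB coefXM mulrBl; congr (_ - _).
  by case: k => [|k] /=; rewrite ?mul0r // coef_scaled_chebyshevU subSS.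
have [kr|rk] := leqP k r; last first.
  by rewrite chebyshevU_coef0 ?rk // !mul0r mulr0.
by rewrite !subSn ?leqW // /= exprS mulrCA.
Qed.

End ScaledChebyshev.

(** Bookkeeping for the induction step of [cycle_sum_nseq_mul]: [p], [q], [s], [u] are the cycle
    sums of lengths 1, r + 1, r and r + 2. *)
Lemma recurrence_error (K : comNzRingType) (A : algType K) (c : K) (p q s u x y z : A) :
  p * (q * x) + (- c) *: (s * x) - (y + (- c) *: z) + (-1) *: ((p * q - u - c *: s) * x) =
  u * x - (y + (- c) *: z).
Proof.
rewrite !scaleNr scale1r !mulrBl -scalerAl mulrA addrAC; congr (_ - _).
by rewrite [_ - u * x - _]addrAC subKr.
Qed.

(** * Asymptotic action of cycle sums on Fock vectors *)

Section Convergence.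
Context (R : realType) (FA : freeStarAlg R R).
Local Notation KG := (groupAlg R[i] finPerm).
Local Notation wickB := (@wick R R FA (fun t s => (tmin t s)%:C)).
Local Notation tau := (@wick_state R R FA (fun t s => (tmin t s)%:C)).
Local Notation annihB := (@annih R R FA (fun t s => (tmin t s)%:C)).
Implicit Types (x y : FA) (w : seq R) (t : R) (n r : nat).

Definition asymp (u v : nat -> KG) := evanescent (fun n => u n - v n).

Lemma evanescent_asymp z u v : evanescent z -> (forall n, (0 < n)%N -> z n = u n - v n) ->
  asymp u v.
Proof. by move=> zN zE; exact: evanescent_eq zE zN. Qed.

Lemma asymp_trans u v z : asymp u v -> asymp v z -> asymp u z.
Proof.
move=> uv vz; apply: (evanescent_asymp (evanescentD uv vz)) => n _.
by rewrite addrA subrK.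
Qed.

Lemma asympD u v u' v' : asymp u v -> asymp u' v' ->
  asymp (fun n => u n + u' n) (fun n => v n + v' n).
Proof.
move=> uv uv'; apply: (evanescent_asymp (evanescentD uv uv')) => n _.
by rewrite opprD addrACA.
Qed.

Lemma asympZ c u v : asymp u v -> asymp (fun n => c *: u n) (fun n => c *: v n).
Proof.
by move=> uv; apply: (evanescent_asymp (evanescentZ c uv)) => n _; rewrite scalerBr.
Qed.

Lemma asympMl k z u v : word_sum k z -> asymp u v ->
  asymp (fun n => z n * u n) (fun n => z n * v n).
Proof.
by move=> zk uv; apply: (evanescent_asymp (evanescentMl zk uv)) => n _; rewrite mulrBr.
Qed.

Definition cycle_ext n : FA -> KG := fext FA (fun w => cycle_sum n w : KG).

HB.instance Definition _ n := GRing.Linear.on (cycle_ext n).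

Lemma cycle_ext_word n w : cycle_ext n (fword FA w) = cycle_sum n w.
Proof. exact: fext_word. Qed.

Lemma cycle_ext0 n : cycle_ext n 0 = 0.
Proof. exact: linear0. Qed.

Lemma cycle_extD n x y : cycle_ext n (x + y) = cycle_ext n x + cycle_ext n y.
Proof. exact: linearD. Qed.

Lemma cycle_extZ n c x : cycle_ext n (c *: x) = c *: cycle_ext n x.
Proof. exact: linearZ. Qed.

Lemma cycle_sum0 n : cycle_sum n [::] = 1 :> KG.
Proof. by rewrite /cycle_sum /letter_wsum expr0 scale1r /wsum big_seq1. Qed.

(** Through [cycle_ext], left multiplication by M_1(n,t) becomes creation plus annihilation. On the
    empty word there is nothing to contract, and no error. *)
Lemma letter_mul_cycle_ext t x : asymp (fun n => cycle_sum n [:: t] * cycle_ext n x)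
  (fun n => cycle_ext n (fword FA [:: t] * x + annihB t x)).
Proof.
elim/fsa_ind: x => [|c w x IH].
  apply: (evanescent_asymp (@evanescent0 R)) => n _.
  by rewrite cycle_ext0 !mulr0 linear0 addr0 cycle_ext0 subr0.
have W : asymp (fun n => cycle_sum n [:: t] * cycle_sum n w)
    (fun n => cycle_ext n (fword FA (t :: w) + annihB t (fword FA w))).
  case: w => [|s w].
    apply: (evanescent_asymp (@evanescent0 R)) => n _.
    by rewrite cycle_sum0 mulr1 fword0 annih1 addr0 cycle_ext_word subrr.
  apply: (evanescent_asymp (letter_mul_cycle_sum t s w)) => n _.
  by rewrite annih_word cycle_extD cycle_extZ !cycle_ext_word opprD addrA.
have E : fword FA [:: t] * (c *: fword FA w + x) + annihB t (c *: fword FA w + x) =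
    c *: (fword FA (t :: w) + annihB t (fword FA w)) +
    (fword FA [:: t] * x + annihB t x).
  by rewrite mulrDr linearP -scalerAr -(fword_cat FA [:: t]) scalerDr addrACA.
apply: (evanescent_asymp (asympD (asympZ c W) IH)) => n _.
rewrite E (cycle_extD n (c *: _) (_ + _)) (cycle_extZ n c (_ + _)) (cycle_extD n (c *: _) x).
by rewrite (cycle_extZ n c (fword FA w)) cycle_ext_word mulrDr scalerAr.
Qed.

(** The parameter [tmin t t], equal to t for t >= 0, is the variance seen by the annihilation
    operator, so the recurrences match for every real t. *)
Definition chebX (p : nat * R) : FA :=
  horner_alg (fword FA [:: p.2]) (scaled_chebyshevU p.1 (tmin p.2 p.2)%:C).

Lemma chebX0 t : chebX (0, t) = 1.
Proof. by rewrite /chebX scaled_chebyshevU0 rmorph1. Qed.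

Lemma chebX1 t : chebX (1, t) = fword FA [:: t].
Proof. by rewrite /chebX scaled_chebyshevU1 /= horner_algX. Qed.

Lemma chebXSS r t : chebX (r.+2, t) =
  fword FA [:: t] * chebX (r.+1, t) - (tmin t t)%:C *: chebX (r, t).
Proof.
by rewrite /chebX scaled_chebyshevUSS -mul_polyC rmorphB !rmorphM /= horner_algX horner_algC -scalerAl mul1r.
Qed.

Lemma evanescent_mul_cycle_ext u x : evanescent u -> evanescent (fun n => u n * cycle_ext n x).
Proof.
move=> un; elim/fsa_ind: x => [|c w x IH].
  by apply: evanescent_eq (@evanescent0 R) => n _; rewrite linear0 mulr0.
apply: evanescent_eq (evanescentD (evanescentZ c (evanescentMr (cycle_sum_word_sum w) un)) IH) => n _.
by rewrite linearD linearZ /= cycle_ext_word mulrDr scalerAr.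
Qed.

(** By [letter_mul_cycle_sum], constant cycle sums satisfy the Chebyshev recurrence [chebXSS] up to
    evanescent terms; strong induction on [r] reduces the claim to single letters. *)
Lemma cycle_sum_nseq_mul r t x : asymp (fun n => cycle_sum n (nseq r t) * cycle_ext n (wickB x))
  (fun n => cycle_ext n (wickB (chebX (r, t) * x))).
Proof.
elim/ltn_ind: r => -[|[|r]] IH.
- apply: (evanescent_asymp (@evanescent0 R)) => n _.
  by rewrite cycle_sum0 !mul1r chebX0 mul1r subrr.
- apply: (evanescent_asymp (letter_mul_cycle_ext t (wickB x))) => n _.
  by rewrite chebX1 wick_cons.
have H1 := asympMl (cycle_sum_word_sum [:: t]) (IH r.+1 (ltnSn _)).
have H2 := asymp_trans H1 (letter_mul_cycle_ext t (wickB (chebX (r.+1, t) * x))).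
have H3 := asympD H2 (asympZ (- (tmin t t)%:C) (IH r (ltnW (ltnSn _)))).
have H4 := evanescent_mul_cycle_ext (wickB x) (letter_mul_cycle_sum t t (nseq r t)).
have E : chebX (r.+2, t) * x = fword FA [:: t] * (chebX (r.+1, t) * x) -
    (tmin t t)%:C *: (chebX (r, t) * x).
  by rewrite chebXSS mulrBl mulrA scalerAl.
have {}E : wickB (chebX (r.+2, t) * x) =
    fword FA [:: t] * wickB (chebX (r.+1, t) * x) + annihB t (wickB (chebX (r.+1, t) * x)) +
    (- (tmin t t)%:C) *: wickB (chebX (r, t) * x).
  by rewrite E -scaleNr linearD linearZ /= wick_cons.
apply: (evanescent_asymp (evanescentD H3 (evanescentZ (-1) H4))) => n _.
rewrite E (cycle_extD n _ (_ *: _)) (cycle_extZ n (- _)); exact: recurrence_error.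
Qed.

End Convergence.

(** * Limits of complex sequences with error of order n^(-1/2) *)

Section Rates.
Context (R : realType).
Implicit Types (u : nat -> R[i]) (l : R[i]).

Definition rate u l := exists D : R[i], forall n, (0 < n)%N -> `|u n - l| <= D * rsqrt R n.

Lemma rate_eq u v l : (forall n, (0 < n)%N -> u n = v n) -> rate u l -> rate v l.
Proof. by move=> uv [D uD]; exists D => n n0; rewrite -uv //; exact: uD. Qed.

Lemma rate_cst l : rate (fun=> l) l.
Proof. by exists 0 => n _; rewrite subrr normr0 mul0r. Qed.

Lemma rateD u v l l' : rate u l -> rate v l' -> rate (fun n => u n + v n) (l + l').
Proof.
move=> [D uD] [E vE]; exists (D + E) => n n0.
rewrite opprD addrACA mulrDl; apply: le_trans (ler_normD _ _) _.
exact: lerD (uD n n0) (vE n n0).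
Qed.

Lemma rateZ c u l : rate u l -> rate (fun n => c * u n) (c * l).
Proof.
move=> [D uD]; exists (`|c| * D) => n n0; rewrite -mulrBr normrM -[leRHS]mulrA.
exact: ler_wpM2l (normr_ge0 _) _ _ (uD n n0).
Qed.

Lemma rate_conj u l : rate u l -> rate (fun n => (u n)^*) l^*.
Proof. by move=> [D uD]; exists D => n n0; rewrite -rmorphB norm_conjC uD. Qed.

Lemma rate_norm u l : rate u l -> rate (fun n => `|u n|) `|l|.
Proof.
by move=> [D uD]; exists D => n n0; apply: le_trans (ler_dist_dist _ _) (uD n n0).
Qed.

Lemma rsqrt_small (e : R) : 0 < e -> exists N : nat, forall n, (N < n)%N -> rsqrt R n <= e%:C.
Proof.
move=> e0; exists (Num.truncn (e ^- 2)) => n nN.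
have n0 : (0 < n)%N by exact: leq_trans nN.
have n0' : 0 < Num.sqrt (n%:R : R) by rewrite sqrtr_gt0 ltr0n.
rewrite /rsqrt lecR -[e]invrK lef_pV2 ?posrE ?invr_gt0 //.
rewrite -[e^-1]gtr0_norm ?invr_gt0 // -sqrtr_sqr ler_wsqrtr // exprVn.
by apply: le_trans (ltW (truncnS_gt _)) _; rewrite ler_nat.
Qed.

Lemma rate_cvg u l : rate u l -> (u @ \oo --> (l : R[i]^o))%classic.
Proof.
move=> [D uD]; apply/(@cvgrPdist_le R[i] R[i]^o) => e e0.
(* At n = 1 the factor [rsqrt] is 1. The division by [D + 1] below covers the case [D = 0]. *)
have D0 : 0 <= D.
  by have := le_trans (normr_ge0 _) (uD 1%N isT); rewrite /rsqrt sqrtr1 invr1 mulr1.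
pose d := e / (D + 1).
have d0 : 0 < d by rewrite divr_gt0 // ltr_wpDl.
have dR : d = (complex.Re d)%:C by rewrite RRe_real // gtr0_real.
have [|N scN] := @rsqrt_small (complex.Re d); first by rewrite -ltcR -dR.
near=> n.
have n0 : (N < n)%N by near: n; exact: nbhs_infty_gt.
rewrite distrC; apply: le_trans (uD n (leq_ltn_trans (leq0n N) n0)) _.
apply: (@le_trans _ _ ((D + 1) * d)); last by rewrite /d mulrCA divff ?mulr1 // gt_eqF // ltr_wpDl.
rewrite ler_pM ?rsqrt_ge0 //; first by rewrite lerDl.
by rewrite dR scN.
Unshelve. all: by end_near.
Qed.

Lemma rate_unique u l l' : rate u l -> rate u l' -> l = l'.
Proof.
move=> /rate_cvg ul /rate_cvg ul'.
exact: (cvg_unique (@norm_hausdorff _ R[i]^o) ul ul').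
Qed.

(** The order on complex numbers is partial, and nonnegativity includes being real. Both come from l
    = |l|, by uniqueness of the limit of [u] and of its modulus. *)
Lemma rate_ge0 u l : (forall n, (0 < n)%N -> 0 <= u n) -> rate u l -> 0 <= l.
Proof.
move=> u0 ul; suff -> : l = `|l| by exact: normr_ge0.
apply: (rate_unique ul); apply: rate_eq (rate_norm ul) => n n0.
by rewrite ger0_norm // u0.
Qed.

End Rates.

(** * M_r(n,t) as a cycle sum *)

Section Mcycles.
Context (R : realType).
Local Notation KG := (groupAlg R[i] finPerm).

Lemma mem_words_nseq r N (w : seq nat) :
  (w \in words (nseq r N)) = (size w == r) && all (fun a => 0 < a <= N)%N w.
Proof.
rewrite mem_words; elim: r w => [|r IH] [|a w] //=.
by rewrite IH eqSS andbCA.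
Qed.

Lemma sum_words_tuple (V : nmodType) r N (F : seq nat -> V) :
  \sum_(a : r.-tuple 'I_N.+1 | uniq a && all (fun i : 'I_N.+1 => (0 < i)%N) a)
    F [seq val i | i <- a] = \sum_(w <- words (nseq r N) | uniq w) F w.
Proof.
pose P (a : r.-tuple 'I_N.+1) := uniq a && all (fun i : 'I_N.+1 => (0 < i)%N) a.
pose g (a : r.-tuple 'I_N.+1) := [seq val i | i <- a].
have gI : injective g.
  by move=> a b /(inj_map val_inj) /val_inj.
rewrite -[LHS](big_filter _ P) -[RHS]big_filter -[LHS](big_map g xpredT F).
apply: perm_big; apply: uniq_perm.
- by rewrite map_inj_uniq // filter_uniq // /index_enum -enumT enum_uniq.
- by rewrite filter_uniq // words_uniq.
move=> w; rewrite mem_filter mem_words_nseq; apply/mapP/and3P.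
  move=> [a]; rewrite mem_filter /P => /andP[/andP[ua a0] _] ->; split.
  - by rewrite map_inj_uniq //; exact: val_inj.
  - by rewrite size_map size_tuple.
  - apply/allP => _ /mapP[i ia ->]; have /= -> := allP a0 _ ia.
    by rewrite -ltnS ltn_ord.
move=> [uw /eqP sw /allP aw].
have wE : w = [seq val i | i <- [seq (inord a : 'I_N.+1) | a <- w]].
  rewrite -map_comp -[LHS]map_id; apply/eq_in_map => a /aw /andP[_ aN] /=.
  by rewrite inordK.
have st : size [seq (inord a : 'I_N.+1) | a <- w] == r by rewrite size_map sw.
exists (Tuple st) => //.
rewrite mem_filter mem_index_enum andbT /P /=; apply/andP; split.
  by rewrite -(map_inj_uniq val_inj) -wE.
by apply/allP => i /(map_f val) /=; rewrite -wE => /aw /andP[].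
Qed.

Lemma powR_half_rsqrt n r : ((n%:R `^ (r%:R / 2))^-1)%:C = rsqrt R n ^+ r.
Proof.
rewrite /rsqrt -rmorphXn /= exprVn mulrC.
rewrite powRrM powR12_sqrt // powR_mulrn ?sqrtr_ge0 //.
Qed.

(** [starw a] is the cycle through the reversal of [a], that is the inverse of the cycle in the
    definition of [Mcycles]; self-adjointness exchanges the two. *)
Lemma Mcycles_cycle_sum r n t : Mcycles r n t = cycle_sum n (nseq r t) :> KG.
Proof.
have scR : (rsqrt R n ^+ r)^* = rsqrt R n ^+ r.
  by apply/CrealP; rewrite ger0_real // exprn_ge0 // rsqrt_ge0.
rewrite -[LHS]Mcycles_self_adjoint [star _]gastarZ gastar_sum powR_half_rsqrt scR.
rewrite /cycle_sum /letter_wsum size_nseq map_nseq; congr (_ *: _).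
transitivity (\sum_(w <- words (nseq r (nletters n t)) | uniq w) << starw w >> : KG).
  rewrite -sum_words_tuple; apply: eq_bigr => a /andP[ua a0].
  have ua' : uniq [seq val i | i <- a] by rewrite map_inj_uniq //; exact: val_inj.
  have a0' : 0%N \notin [seq val i | i <- a].
    by apply/mapP => -[i ia i0]; have /= := allP a0 _ ia; rewrite -i0.
  have us : uniq (0%N :: [seq val i | i <- a]) by rewrite cons_uniq a0'.
  apply: etrans (gastarU _ _) _; rewrite (finperm_cycleV us) (finperm_cycle_starw a0' ua').
  by congr << _ *g _ >>; exact: rmorph1.
rewrite /wsum big_mkcond; apply: eq_bigr => w _.
by case: ifP => // _; rewrite monalgU0.
Qed.

End Mcycles.

(** * Convergence of mixed moments and the limit probability space *)

Section LimitSpace.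
Context (R : realType) (FA : freeStarAlg R R).
Local Notation KG := (groupAlg R[i] finPerm).
Local Notation wickB := (@wick R R FA (fun t s => (tmin t s)%:C)).
Local Notation tau := (@wick_state R R FA (fun t s => (tmin t s)%:C)).
Implicit Types (x y : FA) (w : seq R) (t : R) (n r : nat).

Definition cycle_sum_prod n (v : seq (nat * R)) : KG := \prod_(p <- v) cycle_sum n (nseq p.1 p.2).

Lemma cycle_sum_prod_asymp (v : seq (nat * R)) :
  asymp (cycle_sum_prod ^~ v) (fun n => @cycle_ext R FA n (wickB (\prod_(p <- v) @chebX R FA p))).
Proof.
elim: v => [|[r t] v IH].
  apply: (evanescent_asymp (@evanescent0 R)) => n _.
  by rewrite /cycle_sum_prod !big_nil wick1 -fword0 cycle_ext_word cycle_sum0 subrr.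
rewrite big_cons; have W := asympMl (cycle_sum_word_sum (nseq r t)) IH.
have W' := asymp_trans W (cycle_sum_nseq_mul r t (\prod_(p <- v) @chebX R FA p)).
by apply: evanescent_eq W' => n _; rewrite /cycle_sum_prod big_cons.
Qed.

(** A nonempty word without repetition never has trivial product, so the trace of a cycle sum is the
    vacuum expectation of its word for every n, with no error. *)
Lemma gatrace_cycle_sum n w : gatrace (cycle_sum n w : KG) = (w == [::])%:R.
Proof.
rewrite /cycle_sum /letter_wsum linearZ /= gatrace_wsum.
case: w => [|t w]; first by rewrite expr0 mul1r big_cons big_nil /= eqxx addr0.
rewrite big_seq_cond big1 ?mulr0 // => a /andP[aN /eqP a1].
have [ua|] := boolP (uniq a); last by [].
exfalso; apply: (starw_uniq_neq1 (words0 aN) ua _ a1).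
by have := size_words aN; case: (a).
Qed.

Lemma gatrace_cycle_ext n x : gatrace (@cycle_ext R FA n x : KG) = vacuum x.
Proof.
elim/fsa_ind: x => [|c w x IH]; first by rewrite cycle_ext0 !linear0.
rewrite cycle_extD cycle_extZ cycle_ext_word linearD linearZ /= IH gatrace_cycle_sum.
by rewrite linearD linearZ /= vacuum_word.
Qed.

Lemma cycle_sum_prod_rate (v : seq (nat * R)) :
  rate (fun n => gatrace (cycle_sum_prod n v)) (tau (\prod_(p <- v) @chebX R FA p)).
Proof.
have [D vD] := evanescent_trace (cycle_sum_prod_asymp v).
by exists D => n /vD; rewrite linearB /= gatrace_cycle_ext.
Qed.

(** Evaluates the letters at the M_1(n,t). Unlike [cycle_ext] it respects products and stars, and so
    carries symmetry and positivity of the trace over to the limit state. *)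
Definition letter_eval n : FA -> KG := fext FA (fun w => \prod_(t <- w) (cycle_sum n [:: t] : KG)).

HB.instance Definition _ n := GRing.Linear.on (letter_eval n).

Lemma letter_eval0 n : letter_eval n 0 = 0.
Proof. exact: linear0. Qed.

Lemma letter_eval_word n w : letter_eval n (fword FA w) = \prod_(t <- w) (cycle_sum n [:: t]).
Proof. exact: fext_word. Qed.

Lemma letter_evalZD n c x y : letter_eval n (c *: x + y) = c *: letter_eval n x + letter_eval n y.
Proof. exact: linearP. Qed.

Lemma letter_evalP n c w x :
  letter_eval n (c *: fword FA w + x) = c *: \prod_(t <- w) (cycle_sum n [:: t]) + letter_eval n x.
Proof. by rewrite letter_evalZD letter_eval_word. Qed.

Lemma letter_eval_rate x : rate (fun n => gatrace (letter_eval n x)) (tau x).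
Proof.
elim/fsa_ind: x => [|c w x IH].
  by apply: rate_eq (rate_cst _) => n _; rewrite letter_eval0 !linear0.
have := cycle_sum_prod_rate [seq (1%N, t) | t <- w].
rewrite big_map; under eq_bigr do rewrite chebX1.
have -> : \prod_(t <- w) fword FA [:: t] = fword FA w.
  elim: (w) => [|t w' IHw]; first by rewrite big_nil fword0.
  by rewrite big_cons IHw -fword_cat.
move=> /(rateZ c) wr; rewrite linearD linearZ /=.
apply: rate_eq (rateD wr IH) => n _.
by rewrite letter_evalP linearD linearZ /= /cycle_sum_prod big_map.
Qed.

Lemma letter_evalM n x y : letter_eval n (x * y) = letter_eval n x * letter_eval n y.
Proof.
elim/fsa_ind: x => [|c w x IH]; first by rewrite mul0r letter_eval0 mul0r.
rewrite mulrDl -scalerAl !letter_evalZD IH mulrDl -scalerAl; apply: (f_equal (fun z => c *: z + _)).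
elim/fsa_ind: y {IH} => [|d v y IH]; first by rewrite mulr0 letter_eval0 mulr0.
rewrite mulrDr -scalerAr -fword_cat !letter_evalZD IH mulrDr -scalerAr.
by rewrite !letter_eval_word big_cat.
Qed.

Lemma gastar_letter n t : gastar (cycle_sum n [:: t]) = cycle_sum n [:: t] :> KG.
Proof. by have := Mcycles_self_adjoint 1 n t; rewrite /self_adjoint Mcycles_cycle_sum. Qed.

Lemma gastar_letters n w :
  gastar (\prod_(t <- w) (cycle_sum n [:: t] : KG)) = \prod_(t <- rev w) cycle_sum n [:: t].
Proof.
elim: w => [|t w IH].
  by rewrite !big_nil; apply: etrans (gastarU _ _) _; rewrite rmorph1 invg1.
by rewrite big_cons gastarM IH rev_cons -cats1 big_cat big_seq1 gastar_letter.
Qed.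

Lemma letter_eval_star n x : letter_eval n (fstar x) = gastar (letter_eval n x).
Proof.
elim/fsa_ind: x => [|c w x IH].
  rewrite fstar0 letter_eval0; apply/malgP => g.
  by rewrite gastarE !mcoeff0 rmorph0.
rewrite fstarP !letter_evalP gastarD gastarZ -IH; apply: (f_equal (fun z => c^* *: z + _)).
by rewrite gastar_letters.
Qed.

Lemma fstarD x y : fstar (x + y) = fstar x + fstar y.
Proof.
elim/fsa_ind: x => [|c w x IH]; first by rewrite fstar0 !add0r.
by rewrite -addrA !fstarP IH addrA.
Qed.

Lemma fstarZ (c : R[i]) x : fstar (c *: x) = c^* *: fstar x.
Proof.
elim/fsa_ind: x => [|d w x IH]; first by rewrite scaler0 fstar0 scaler0.
by rewrite scalerDr scalerA !fstarP IH scalerDr scalerA rmorphM.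
Qed.

Lemma fstar_word w : fstar (fword FA w) = fword FA (rev w).
Proof. by have := fstarP (1 : R[i]) w (0 : FA); rewrite fstar0 rmorph1 !scale1r !addr0. Qed.

Lemma fstarM x y : fstar (x * y) = fstar y * fstar x.
Proof.
elim/fsa_ind: x => [|c w x IH]; first by rewrite mul0r fstar0 mulr0.
rewrite mulrDl fstarD IH fstarP mulrDr; congr (_ + _).
rewrite -scalerAl -scalerAr fstarZ; congr (_ *: _).
elim/fsa_ind: y {IH} => [|d v y IH]; first by rewrite mulr0 fstar0 mul0r.
rewrite mulrDr fstarD IH fstarP mulrDl; congr (_ + _).
by rewrite -scalerAl -scalerAr fstarZ -!fword_cat fstar_word rev_cat.
Qed.

Lemma fstarK : involutive (@fstar R R FA).
Proof.
elim/fsa_ind => [|c w x IH]; first by rewrite !fstar0.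
by rewrite fstarP fstarP conjCK revK IH.
Qed.

Lemma tau1 : tau 1 = 1.
Proof. by rewrite /wick_state wick1 -fword0 vacuum_word. Qed.

Lemma tau_star x : tau (fstar x) = (tau x)^*.
Proof.
apply: rate_unique (letter_eval_rate _) _; apply: rate_eq (rate_conj (letter_eval_rate x)) => n _.
by rewrite letter_eval_star gatrace_star.
Qed.

Lemma tau_ge0 x : 0 <= tau (x * fstar x).
Proof.
apply: rate_ge0 (letter_eval_rate _) => n _.
by rewrite letter_evalM letter_eval_star; exact: gatrace_ge0.
Qed.

Definition limitSpace : ncProbSpace R :=
  @NCProbSpace R FA fstar tau fstarD fstarZ fstarM fstarK tau1 tau_star tau_ge0.

End LimitSpace.

(** * Chebyshev polynomials and the semicircle law *)

Section SemicircleIntegral.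
Context (R : realType).
Implicit Types (s t x : R).
Local Notation mu := (@lebesgue_measure R).

(** Differentiability is asked on the open interval only: [chord] has vertical tangents at -2 and
    2. *)
Lemma Rintegral_FTC2 (f F : R -> R) (a b : R) : a < b ->
  continuous f -> continuous F ->
  (forall x, a < x < b -> is_derive x 1 F (f x)) ->
  (\int[mu]_(x in `[a, b]%classic) f x) = F b - F a.
Proof.
move=> ab cf cF dF; rewrite /Rintegral (@continuous_FTC2 _ f F) //.
- by apply: continuous_subspaceT => x; exact: cf.
- split=> [x|  |].
  + by rewrite in_itv /= => /dF[].
  + by apply: cvg_at_right_filter; exact: cF.
  + by apply: cvg_at_left_filter; exact: cF.
- by move=> x; rewrite in_itv /= => /dF xF; rewrite derive1E derive_val.
Qed.

Definition chord s : R := Num.sqrt (4 - s ^+ 2).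

Lemma chord_continuous : continuous chord.
Proof.
move=> x; apply: (@continuous_comp _ _ _ (fun s => 4 - s ^+ 2) Num.sqrt).
  by apply: cvgB; [exact: cvg_cst|exact: exprn_continuous].
exact: sqrt_continuous.
Qed.

Lemma chord_arg_gt0 x : -2 < x < 2 -> 0 < 4 - x ^+ 2.
Proof. by move=> /andP[x1 x2]; nra. Qed.

Lemma chord_gt0 x : -2 < x < 2 -> 0 < chord x.
Proof. by move=> /chord_arg_gt0 x2; rewrite sqrtr_gt0. Qed.

Lemma chord_sqr x : -2 < x < 2 -> chord x ^+ 2 = 4 - x ^+ 2.
Proof. by move=> /chord_arg_gt0 x2; rewrite sqr_sqrtr // ltW. Qed.

Lemma chord_derive x : -2 < x < 2 -> is_derive x 1 chord (- x / chord x).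
Proof.
move=> x2; have xs := is_derive1_sqrt (chord_arg_gt0 x2).
have xq : is_derive x (1 : R) (fun s : R => 4 - s ^+ 2) (- (x *+ 2)).
  have -> : (fun s => 4 - s ^+ 2) = horner (4%:P - 'X^2).
    by apply/funext => y; rewrite !hornerE.
  apply: is_derive_eq (is_derive_poly _ x) _.
  by rewrite derivB derivC derivXn !hornerE /=; ring.
have := @is_derive1_comp _ Num.sqrt (fun s => 4 - s ^+ 2) x _ _ xs xq.
move=> H; apply: is_derive_eq H _.
have c0 : chord x != 0 by rewrite gt_eqF // chord_gt0.
rewrite -/(chord x); field => //.
Qed.

(** At s = 2 cos x this is the derivative of sin((n + 2) x) / sin x; the proof is by induction on
    the three-term recurrence. *)
Lemma chebyshevU_deriv (n : nat) s :
  (4 - s ^+ 2) * (chebyshevU R n.+1)^`().[s] =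
  n.+3%:R * (chebyshevU R n).[s] - n.+1%:R * (chebyshevU R n.+2).[s].
Proof.
have U k : chebyshevU R k.+2 = 'X * chebyshevU R k.+1 - chebyshevU R k by [].
elim/ltn_ind: n => -[|[|n]] IH.
- by rewrite U /= derivX !hornerE; ring.
- by rewrite !U /= derivB derivM derivX derivC !hornerE; ring.
have I1 := IH n.+1 (ltnSn _); have I0 := IH n (ltnW (ltnSn _)).
move: I0 I1; rewrite !U !(derivB, derivM, derivX) !hornerE.
set a := (chebyshevU R n.+1).[s]; set b := (chebyshevU R n).[s].
move=> I0 I1.
rewrite mulrBr mulrDr [(4 - s ^+ 2) * (s * _)]mulrCA I1 I0.
by ring.
Qed.

Lemma Rintegral_chebyshev_chord (r : nat) : (0 < r)%N ->
  (\int[mu]_(s in `[(-2)%R, 2%R]%classic) ((chebyshevU R r).[s] * chord s)) = 0.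
Proof.
case: r => // r _.
have U k : chebyshevU R k.+2 = 'X * chebyshevU R k.+1 - chebyshevU R k by [].
(* With s = 2 cos x the integrand is a combination of cosines of r x and (r+2) x. *)
pose Q := (r.+3%:R)^-1 *: chebyshevU R r.+2 - (r.+1%:R)^-1 *: chebyshevU R r.
(* As [chord] has derivative -s / chord, this says that [chord * Q] is a primitive of the integrand;
   it vanishes at both endpoints. *)
have dQ s : (4 - s ^+ 2) * Q^`().[s] - s * Q.[s] = (4 - s ^+ 2) * (chebyshevU R r.+1).[s].
  rewrite /Q; case: (r) => [|k].
    rewrite !U /= !(derivB, derivZ, derivM, derivX, derivC) !hornerE.
    by field.
  rewrite derivB !derivZ !(hornerD, hornerN, hornerZ) mulrBr ![(4 - s ^+ 2) * (_ * _)]mulrCA.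
  rewrite !chebyshevU_deriv !U !(hornerD, hornerN, hornerM, hornerX).
  set a := (chebyshevU R k.+1).[s]; set b := (chebyshevU R k).[s].
  by field; rewrite -!natrD !pnatr_eq0.
pose F s := chord s * Q.[s].
apply: (@etrans _ _ (F 2 - F (-2))); last first.
  by rewrite /F /chord sqrrN (_ : 4 - 2 ^+ 2 = 0) ?sqrtr0 ?mul0r ?subrr //; ring.
apply: Rintegral_FTC2.
- by lra.
- by move=> x; apply: cvgM; [exact: continuous_horner|exact: chord_continuous].
- by move=> x; apply: cvgM; [exact: chord_continuous|exact: continuous_horner].
- move=> x x2; have dc := chord_derive x2; have dq := is_derive_poly Q x.
  apply: is_derive_eq (is_deriveM dc dq) _.
  have c0 : chord x != 0 by rewrite gt_eqF // chord_gt0.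
  apply: (mulIf c0); rewrite -[RHS]mulrA -expr2 chord_sqr // [RHS]mulrC -dQ -chord_sqr //.
  rewrite -[_ *: _]/(_ * _) -[X in _ + X]/(_ * _).
  by field.
Qed.

Lemma Rintegral_chord :
  (\int[mu]_(s in `[(-2)%R, 2%R]%classic) chord s) = 2 * pi.
Proof.
(* 2 atan (u s) = asin (s / 2), but atan \o u is continuous up to the endpoints. *)
pose u s : R := s / (2 + chord s).
have cp s : 0 < 2 + chord s by rewrite ltr_pwDl // sqrtr_ge0.
have uc : continuous u.
  move=> x; apply: cvgM => //; apply: cvgV; first by rewrite gt_eqF.
  by apply: cvgD; [exact: cvg_cst|exact: chord_continuous].
pose F s := s * chord s / 2 + 4 * atan (u s).
apply: (@etrans _ _ (F 2 - F (-2))); last first.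
  have c2 : chord 2 = 0 by rewrite /chord (_ : 4 - 2 ^+ 2 = 0) ?sqrtr0 //; ring.
  have cN2 : chord (-2) = 0 by rewrite /chord sqrrN.
  have u2 : u 2 = 1 by rewrite /u c2 addr0 divff.
  have uN2 : u (-2) = -1 by rewrite /u cN2 addr0 mulNr divff.
  by rewrite /F c2 cN2 u2 uN2 atanN atan1; field.
apply: Rintegral_FTC2.
- by lra.
- exact: chord_continuous.
- move=> x; apply: cvgD; apply: cvgM => //.
  + by apply: cvgM => //; exact: chord_continuous.
  + exact: cvg_cst.
  + exact: cvg_cst.
  + apply: (@continuous_comp _ _ _ u atan); first exact: uc.
    exact: continuous_atan.
- move=> x x2; have dc := chord_derive x2.
  have c0 : chord x != 0 by rewrite gt_eqF // chord_gt0.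
  have c2 : 2 + chord x != 0 by rewrite gt_eqF.
  have xs : x ^+ 2 = 4 - chord x ^+ 2 by rewrite chord_sqr // subKr.
  have du : is_derive x 1 u (2 / (chord x * (2 + chord x))).
    have dd := is_deriveD (is_derive_cst (2 : R) x (1 : R)) dc.
    have dv := @is_deriveV _ (fun s => 2 + chord s) x _ _ c2 dd.
    have H : is_derive x 1 u _ := is_deriveM (is_derive_id x (1 : R)) dv.
    apply: is_derive_eq H _.
    rewrite /GRing.scale /= (_ : _ + _ =
      (x ^+ 2 + chord x * (2 + chord x)) / (chord x * (2 + chord x) ^+ 2)); last first.
      by field; rewrite c0 c2.
    by rewrite xs; field; rewrite c0 c2.
  have da := @is_derive1_comp _ atan u x _ _ (is_derive1_atan _) du.
  have d1 := is_deriveM (is_derive_id x (1 : R)) dc.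
  have H : is_derive x 1 (fun s => 2^-1 *: (s * chord s) + 4 *: atan (u s)) _ :=
    is_deriveD (is_deriveZ 2^-1 d1) (is_deriveZ 4 da).
  have -> : F = (fun s => 2^-1 *: (s * chord s) + 4 *: atan (u s)).
    by apply/funext => y; rewrite /F mulrC.
  apply: is_derive_eq H _.
  have ux : 1 + u x ^+ 2 = 4 / (2 + chord x).
    rewrite /u (_ : _ + _ = (x ^+ 2 + (2 + chord x) ^+ 2) / (2 + chord x) ^+ 2); last by field.
    by rewrite xs; field.
  rewrite /GRing.scale /= ux.
  rewrite (_ : _ + _ = (4 + chord x ^+ 2 - x ^+ 2) / (2 * chord x)); last by field; rewrite c0 c2.
  by rewrite xs; field.
Qed.

Lemma continuous_integrable_itv (f : R -> R) (a b : R) : continuous f ->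
  mu.-integrable `[a, b]%classic (EFin \o f).
Proof.
move=> cf; apply: continuous_compact_integrable; first exact: segment_compact.
by apply: continuous_subspaceT => x; exact: cf.
Qed.

Definition semicircle_mean (t : R) (p : {poly R}) : R :=
  \int[mu]_(s in `[(-2)%R, 2%R]%classic) (p.[Num.sqrt t * s] * semicircle_density s).

Lemma semicircle_integrand_continuous (t : R) (p : {poly R}) :
  continuous (fun s => p.[Num.sqrt t * s] * semicircle_density s).
Proof.
move=> x; apply: cvgM; last by apply: cvgM; [exact: chord_continuous|exact: cvg_cst].
apply: (@continuous_comp _ _ _ (fun s => Num.sqrt t * s) (horner p)).
  by apply: cvgM => //; exact: cvg_cst.
exact: continuous_horner.
Qed.

Lemma semicircle_mean_linear t (c : R) (p q : {poly R}) :
  semicircle_mean t (c *: p + q) = c * semicircle_mean t p + semicircle_mean t q.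
Proof.
have ip r := continuous_integrable_itv (-2) 2 (@semicircle_integrand_continuous t r).
have ic : mu.-integrable `[(-2)%R, 2%R]%classic (EFin \o
    (fun s => c * (p.[Num.sqrt t * s] * semicircle_density s))).
  apply: continuous_integrable_itv => x; apply: cvgM; first exact: cvg_cst.
  exact: semicircle_integrand_continuous.
rewrite /semicircle_mean -(@RintegralZl _ _ _ mu _ _ c (measurable_itv _) (ip p)).
rewrite -(@RintegralD _ _ _ mu _ _ _ (measurable_itv _) ic (ip q)).
by apply: eq_Rintegral => s _; rewrite hornerD hornerZ; ring.
Qed.

Lemma horner_scaled_chebyshevU r t s : 0 <= t ->
  (scaled_chebyshevU r t).[Num.sqrt t * s] = Num.sqrt t ^+ r * (chebyshevU R r).[s].
Proof.
move=> t0; elim/ltn_ind: r => -[|[|r]] IH.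
- by rewrite scaled_chebyshevU0 /= !hornerC expr0 mulr1.
- by rewrite scaled_chebyshevU1 /= !hornerX expr1.
rewrite scaled_chebyshevUSS hornerD hornerN hornerZ hornerM hornerX !IH //.
rewrite [chebyshevU R r.+2]/('X * chebyshevU R r.+1 - chebyshevU R r).
rewrite !(hornerD, hornerN, hornerM, hornerX).
have := sqr_sqrtr t0; move: (Num.sqrt t) => x; move: (_.[s]) (_.[s]) => a b <-.
by rewrite !exprS; ring.
Qed.

Lemma semicircle_mean_chebyshev r t : 0 <= t ->
  semicircle_mean t (scaled_chebyshevU r t) = (r == 0)%:R.
Proof.
move=> t0; have pi2 : 2 * pi != 0 :> R by rewrite mulf_neq0 // gt_eqF // pi_gt0.
transitivity (Num.sqrt t ^+ r / (2 * pi) *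
  \int[mu]_(s in `[(-2)%R, 2%R]%classic) ((chebyshevU R r).[s] * chord s)).
  rewrite -RintegralZl //; last first.
    apply: continuous_integrable_itv => x.
    by apply: cvgM; [exact: continuous_horner|exact: chord_continuous].
  apply: eq_Rintegral => s _; rewrite horner_scaled_chebyshevU // /semicircle_density.
  by rewrite -/(chord s); ring.
case: r => [|r]; last by rewrite Rintegral_chebyshev_chord // mulr0.
rewrite expr0 mul1r -[RHS](mulVf pi2) -Rintegral_chord; congr (_ * _).
by apply: eq_Rintegral => s _; rewrite /= hornerC mul1r.
Qed.

End SemicircleIntegral.

(** The scaled Chebyshev polynomials are monic, one in each degree, and therefore span all
    polynomials. *)
Lemma chebyshev_poly_ind (K : comNzRingType) (t : K) (P : {poly K} -> Prop) :
  P 0 -> (forall c p q, P p -> P q -> P (c *: p + q)) ->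
  (forall r, P (scaled_chebyshevU r t)) -> forall p, P p.
Proof.
move=> P0 PD PU; suff PX k : P 'X^k.
  move=> p; rewrite -[p]coefK poly_def; elim/big_ind: _ => // [x y Px Py|i _].
    by rewrite -[x]scale1r; exact: PD.
  by rewrite -[_ *: _]addr0; exact: PD.
elim/ltn_ind: k => k IH.
(* The difference in parentheses has degree below k, so the induction hypothesis applies to its
   monomials. *)
have -> : 'X^k = (-1) *: (scaled_chebyshevU k t - 'X^k) + scaled_chebyshevU k t.
  by rewrite scaleN1r opprB subrK.
apply: (PD) => //; set q := _ - _.
have lead : (chebyshevU K k)`_k = 1.
  elim/ltn_ind: (k) => -[|[|m]] IHm; rewrite ?coef1 ?coefX //.
  transitivity (('X * chebyshevU K m.+1 - chebyshevU K m)`_m.+2); first by [].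
  have cm : (chebyshevU K m)`_m.+2 = 0 by rewrite chebyshevU_coef0 // leqW.
  by rewrite coefB coefXM cm subr0 -(IHm m.+1).
have qk i : (k <= i)%N -> q`_i = 0.
  rewrite leq_eqVlt coefB coefXn coef_scaled_chebyshevU => /orP[/eqP<-|ki].
    by rewrite lead subnn expr0 mulr1 eqxx subrr.
  by rewrite chebyshevU_coef0 ?ki // mul0r gtn_eqF // subrr.
have -> : q = \sum_(i < k) q`_i *: 'X^i.
  rewrite -poly_def; apply/polyP => i; rewrite coef_poly.
  by case: ltnP => // /qk.
elim/big_ind: _ => // [x y Px Py|i _]; first by rewrite -[x]scale1r; exact: PD.
by rewrite -[_ *: _]addr0; apply: PD => //; exact: IH.
Qed.

(** * The limit is a free Brownian motion *)

Section Freeness.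
Context (R : realType) (I : choiceType) (FA : freeStarAlg R I) (B : I -> I -> R[i]).
Local Notation wickB := (@wick R I FA B).
Context (J : eqType) (L : J -> seq (R[i] * I)).
Context (ortho : forall i j, i != j -> fcov B (L i) (L j) = 0).

(** Induction from the right: the vector of the tail starts with a field of its first index, which
    the annihilators of the neighbouring index kill by [ortho]. The next centered factor can then
    only create, up to Wick ordering. *)
Lemma wick_alternating (s : seq (J * FA)) :
  sorted (fun u v => u.1 != v.1) s ->
  (forall u, u \in s -> exists2 p, horner_alg (fock_field FA (L u.1)) p = u.2 &
    wick_state B u.2 = 0) ->
  if s is u :: _ then exists y, wickB (\prod_(u <- s) u.2) = fock_field FA (L u.1) * y
  else wickB (\prod_(u <- s) u.2) = 1.
Proof.
elim: s => [|[j x] s IH] ss sx; first by rewrite big_nil wick1.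
have {}IH := IH (path_sorted ss) (fun u us => sx u (@mem_behead _ ((j, x) :: s) u us)).
have [p /= px x0] := sx _ (mem_head _ _).
rewrite big_cons /= -px; apply: wick_state_field_poly; first by rewrite px.
case: s ss IH {sx} => [|[k z] s] /= ss IH; first by rewrite IH annihs1.
case: IH => y ->; rewrite annihs_field ortho ?scale0r //.
by case/andP: ss.
Qed.

End Freeness.

(** * Free increments *)

Section Increments.
Context (R : realType) (FA : freeStarAlg R R).
Local Notation B := (fun t s : R => (tmin t s)%:C).

Lemma tminC (s t : R) : tmin s t = tmin t s.
Proof. by rewrite /tmin minC. Qed.

Lemma tmin_le (s t : R) : 0 <= s -> s <= t -> tmin s t = s.
Proof. by move=> s0 st; rewrite /tmin min_l // max_r. Qed.

Definition incr_coord (t : nat -> R) (i : nat) : seq (R[i] * R) :=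
  if i is j.+1 then [:: (1, t j.+1); (-1, t j)] else [:: (1, t 0%N)].

Lemma field_incr_coord (t : nat -> R) i (A := limitSpace FA) :
  fock_field FA (incr_coord t i) = increment (fun t => fword FA [:: t] : A) t i.
Proof.
rewrite /fock_field; case: i => [|i] /=; first by rewrite big_seq1 scale1r.
by rewrite big_cons big_seq1 /= scale1r scaleN1r.
Qed.

Lemma fcovC (L L' : seq (R[i] * R)) : fcov B L L' = fcov B L' L.
Proof.
rewrite /fcov exchange_big; apply: eq_bigr => p _; apply: eq_bigr => q _.
by rewrite tminC [p.1 * _]mulrC.
Qed.

(** Every time p occurring in the earlier increment is at most both times of the later one, so the
    two minima equal p and cancel. *)
Lemma fcov_incr_lt (k : nat) (t : nat -> R) (i j : nat) : 0 <= t 0%N ->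
  (forall i, (i < k)%N -> t i < t i.+1) -> (i < j <= k)%N ->
  fcov B (incr_coord t i) (incr_coord t j) = 0.
Proof.
move=> t0 tS /andP[ij jk].
have tle a b : (a <= b)%N -> (b <= k)%N -> t a <= t b.
  elim: b => [|b IH]; first by rewrite leqn0 => /eqP->.
  rewrite leq_eqVlt => /orP[/eqP-> //|]; rewrite ltnS => ab bk.
  by apply: le_trans (IH ab (ltnW bk)) _; apply: ltW; exact: tS.
have t_ge0 a : (a <= k)%N -> 0 <= t a by move=> ak; exact: le_trans t0 (tle _ _ _ ak).
case: j ij jk => // j; rewrite ltnS => ij jk.
rewrite /fcov big_seq big1 // => p pi.
have [p0 pj] : 0 <= p.2 /\ p.2 <= t j.
  have jk' := ltnW jk.
  case: (i) ij pi => [|i'] ij; rewrite ?in_cons in_nil orbF.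
    by move/eqP => -> /=; split; [exact: t0 | exact: tle].
  by case/orP => /eqP-> /=; split; rewrite ?t_ge0 ?tle // ?(leq_trans (ltnW ij)) // (leq_trans ij).
rewrite big_cons big_seq1 /= !tmin_le //.
  by rewrite mulr1 mulrN1 mulNr subrr.
by apply: le_trans pj _; exact: tle.
Qed.

Lemma increments_free : free_increments (A := limitSpace FA) (fun t => fword FA [:: t]).
Proof.
move=> k t t0 tS s s0 ss sx.
have ortho (i j : 'I_k.+1) : i != j ->
    fcov B (incr_coord t i) (incr_coord t j) = 0.
  rewrite neq_ltn => /orP[ij|ji].
    by apply: (@fcov_incr_lt k) => //; rewrite ij -ltnS ltn_ord.
  by rewrite fcovC; apply: (@fcov_incr_lt k) => //; rewrite ji -ltnS ltn_ord.
have := @wick_alternating R R FA B _ (fun i : 'I_k.+1 => incr_coord t i) ortho s ss.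
case: s s0 ss sx => // u s _ ss sx /(_ _)[v vs|y yE].
  have [[p _ px] x0] := sx v vs.
  by exists p => //; rewrite field_incr_coord.
change (wick_state B (\prod_(v <- u :: s) v.2) = 0).
by rewrite /wick_state yE vacuum_field.
Qed.

End Increments.

(** * Law of the limit process and convergence *)

Section Assembly.
Context (R : realType) (FA : freeStarAlg R R).
Local Notation A := (limitSpace FA).
Local Notation B := (fun t s : R => (tmin t s)%:C).

(** Takes t itself as parameter, as the Chebyshev relation demands; it agrees with [chebX] for t >=
    0. *)
Definition limitM (r : nat) (t : R) : A :=
  horner_alg (fword FA [:: t]) (scaled_chebyshevU r t%:C).

Lemma limitM1 t : limitM 1 t = fword FA [:: t].
Proof. by rewrite /limitM scaled_chebyshevU1 /= horner_algX. Qed.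

Lemma limitM_chebX r t : 0 <= t -> limitM r t = chebX FA (r, t).
Proof. by move=> t0; rewrite /limitM /chebX /= tmin_le. Qed.

Lemma fstar_letter t : fstar (fword FA [:: t]) = fword FA [:: t].
Proof. exact: fstar_word. Qed.

Lemma chebX_comm r t :
  fword FA [:: t] * chebX FA (r, t) = chebX FA (r, t) * fword FA [:: t].
Proof.
rewrite /chebX /=; set p := scaled_chebyshevU _ _.
transitivity (horner_alg (fword FA [:: t]) ('X * p)).
  by rewrite rmorphM /= horner_algX.
by rewrite -commr_polyX rmorphM /= horner_algX.
Qed.

(** The star reverses the products in the recurrence, and [chebX_comm] puts them back in order. *)
Lemma limitM_self_adjoint r t : 0 <= t -> self_adjoint (limitM r t).
Proof.
move=> t0; rewrite /self_adjoint limitM_chebX // -[star _]/(fstar _).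
elim/ltn_ind: r => -[|[|r]] IH.
- by rewrite chebX0 -fword0 fstar_word.
- by rewrite chebX1 fstar_letter.
have cR : (- (tmin t t)%:C)^* = - (tmin t t)%:C :> R[i].
  by apply/CrealP; rewrite rpredN complex_real.
rewrite chebXSS -scaleNr fstarD fstarZ fstarM fstar_letter !IH //.
by rewrite cR chebX_comm.
Qed.

(** In the recurrence the annihilation term is exactly the one that is subtracted, so only creation
    remains. *)
Lemma wick_chebX r t : wick B (chebX FA (r, t)) = fword FA (nseq r t).
Proof.
elim/ltn_ind: r => -[|[|r]] IH.
- by rewrite chebX0 wick1 fword0.
- by rewrite chebX1 -[fword FA [:: t]]mulr1 wick_cons wick1 annih1 addr0.
rewrite chebXSS -scaleNr linearD linearZ /= wick_cons !IH // annih_word scaleNr addrK.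
by rewrite -fword_cat.
Qed.

Lemma map_chebyshevU r : map_poly (real_complex R) (chebyshevU R r) = chebyshevU R[i] r.
Proof.
elim/ltn_ind: r => -[|[|r]] IH; first by rewrite /= rmorph1.
  by rewrite /= map_polyX.
have U (K : comNzRingType) : chebyshevU K r.+2 = 'X * chebyshevU K r.+1 - chebyshevU K r by [].
transitivity (map_poly (real_complex R) 'X * map_poly (real_complex R) (chebyshevU R r.+1) -
    map_poly (real_complex R) (chebyshevU R r)).
  by rewrite U rmorphB rmorphM.
by rewrite U map_polyX (IH r.+1) // (IH r) // ltnW.
Qed.

Lemma map_scaled_chebyshevU r t :
  map_poly (real_complex R) (scaled_chebyshevU r t) = scaled_chebyshevU r t%:C.
Proof.
apply/polyP => k; rewrite coef_map !coef_scaled_chebyshevU -map_chebyshevU coef_map.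
by rewrite -(rmorphXn (real_complex R)) -(rmorphM (real_complex R)).
Qed.

(** Both sides are linear in [p], and on the scaled Chebyshev polynomials both are 1 for r = 0 and 0
    otherwise. *)
Lemma state_poly_letter t (p : {poly R}) : 0 <= t ->
  wick_state B (horner_alg (fword FA [:: t]) (map_poly (real_complex R) p)) =
  (semicircle_mean t p)%:C.
Proof.
move=> t0; elim/(@chebyshev_poly_ind _ t): p => [|c p q IHp IHq|r].
- have := semicircle_mean_linear t (-1) 0 0.
  by rewrite scaler0 addr0 mulN1r addNr => ->; rewrite !rmorph0 linear0.
- rewrite semicircle_mean_linear rmorphD /= map_polyZ -mul_polyC rmorphD rmorphM /=.
  by rewrite horner_algC -scalerAl mul1r linearD linearZ /= IHp IHq rmorphD rmorphM.
rewrite map_scaled_chebyshevU semicircle_mean_chebyshev // rmorph_nat.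
rewrite -[horner_alg _ _]/(limitM r t) limitM_chebX // /wick_state wick_chebX vacuum_word.
by case: r.
Qed.

Lemma limitM1_semicircular t : 0 <= t -> semicircular (A := A) t (limitM 1 t).
Proof.
move=> t0; split=> [|k]; first exact: limitM_self_adjoint.
rewrite limitM1 -[LHS]/(wick_state B (fword FA [:: t] ^+ k)).
have := state_poly_letter 'X^k t0; rewrite map_polyXn rmorphXn /= horner_algX => ->.
by congr (_%:C); apply: eq_Rintegral => s _; rewrite hornerXn.
Qed.

Lemma limitM1_brownian : free_brownian_motion (A := A) (limitM 1).
Proof.
split; last exact: limitM1_semicircular.
have -> : limitM 1 = (fun t => fword FA [:: t]) by apply/funext => t; exact: limitM1.
exact: increments_free.
Qed.

Lemma nc_distributionE (S : ncProbSpace R) (I : choiceType) (x : I -> S) (P : ncPoly R I) :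
  nc_distribution x P = \sum_(m <- msupp P) P@_m * state (\prod_(i <- m) x i).
Proof.
rewrite /nc_distribution /nc_eval /mmap linear_sum; apply: eq_bigr => m _.
by rewrite -scalerAl mul1r linearZ.
Qed.

Lemma rate_sum (T : Type) (r : seq T) (c : T -> R[i]) (u : nat -> T -> R[i]) (l : T -> R[i]) :
  (forall i, rate (u ^~ i) (l i)) ->
  rate (fun n => \sum_(i <- r) c i * u n i) (\sum_(i <- r) c i * l i).
Proof.
move=> ul; elim: r => [|i r IH].
  by apply: rate_eq (rate_cst _) => n _; rewrite !big_nil.
rewrite big_cons; apply: rate_eq (rateD (rateZ (c i) (ul i)) IH) => n _.
by rewrite big_cons.
Qed.

(** By linearity only monomials matter, and these are the mixed moments of [cycle_sum_prod_rate].
    Indices in [cycleIndex] have t >= 0, where [limitM] and [chebX] agree. *)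
Lemma limitM_cvg : cvg_distribution
  (fun (n : nat) (p : cycleIndex R) => Mcycles (val p).1 n (val p).2)
  (fun p : cycleIndex R => limitM (val p).1 (val p).2).
Proof.
move=> P; apply: rate_cvg; rewrite nc_distributionE.
have mE (m : {fmonom cycleIndex R}) : rate
    (fun n => state (\prod_(p <- m) (Mcycles (val p).1 n (val p).2 : CS R)))
    (@state _ A (\prod_(p <- m) (limitM (val p).1 (val p).2))).
  have := cycle_sum_prod_rate FA [seq val p | p <- m]; rewrite big_map.
  have E : \prod_(p <- m) chebX FA (val p) = \prod_(p <- m) (limitM (val p).1 (val p).2 : FA).
    apply: eq_bigr => p _; case: p => -[r t] /= /andP[_ t0].
    by rewrite limitM_chebX.
  rewrite E; apply: rate_eq => n _; rewrite /cycle_sum_prod big_map.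
  apply: (f_equal (@gatrace R finPerm)).
  by apply: eq_bigr => p _; rewrite Mcycles_cycle_sum.
by apply: rate_eq (rate_sum (msupp P) (fun m => P@_m) mE) => n _; rewrite nc_distributionE.
Qed.

End Assembly.

Theorem theorem1 (R : realType) :
  exists (A : ncProbSpace R) (M : nat -> R -> A),
    [/\ forall (r : nat) (t : R), (0 < r)%N -> 0 <= t -> self_adjoint (M r t),
        free_brownian_motion (M 1%N),
        forall (r : nat) (t : R), (0 < r)%N -> 0 <= t ->
          M r t = horner_alg (M 1%N t) (scaled_chebyshevU r t%:C)
      & cvg_distribution
          (fun (n : nat) (p : cycleIndex R) => Mcycles (val p).1 n (val p).2)
          (fun p : cycleIndex R => M (val p).1 (val p).2)].
Proof.
pose FA := freeStarAlg_exists R R.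
exists (limitSpace FA), (@limitM R FA); split.
- by move=> r t _ t0; exact: limitM_self_adjoint.
- exact: limitM1_brownian.
- by move=> r t _ _; rewrite limitM1.
- exact: limitM_cvg.
Qed.
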